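(* Let $m\ge 1$, let $\tau_d=(t_l)_{l=1}^{|\tau_d|}$ be a finite sampling grid in $[0,1]$ and $B=(B^1,\dots,B^m)$ a boundary conditions operator on $\mathcal{H}^m$ such that the points $t_l$ are distinct, $|\tau_d|\ge m$, and the linear forms $B^1,\dots,B^m$ are linearly independent from the $|\tau_d|$ linear forms $h\mapsto h(t_l)$, $l=1,\dots,|\tau_d|$, on $\mathcal{H}^m$. Let $\lambda>0$, and let $(X,Y)$ be a pair of random variables with $X$ taking values in $\mathcal{H}^m$. Put $\mathbf{X}^{\tau_d}=(X(t_1),\dots,X(t_{|\tau_d|}))^T\in\mathbb{R}^{|\tau_d|}$ and let $\widehat{X}_{\lambda,\tau_d}$ be the smoothing spline estimate of $X$. Then: (i) (binary classification) if $Y$ takes values in $\{-1,1\}$, $$\inf_{\phi:\mathcal{H}^m\to\{-1,1\}}\mathbb{P}\left(\phi(\widehat{X}_{\lambda,\tau_d})\ne Y\right)=\inf_{\phi:\mathbb{R}^{|\tau_d|}\to\{-1,1\}}\mathbb{P}\left(\phi(\mathbf{X}^{\tau_d})\ne Y\right);$$ (ii) (regression) if $Y$ is real valued with $\mathbb{E}(Y^2)<\infty$, $$\inf_{\phi:\mathcal{H}^m\to\mathbb{R}}\mathbb{E}\left(\left[\phi(\widehat{X}_{\lambda,\tau_d})-Y\right]^2\right)=\inf_{\phi:\mathbb{R}^{|\tau_d|}\to\mathbb{R}}\mathbb{E}\left(\left[\phi(\mathbf{X}^{\tau_d})-Y\right]^2\right).$$ All infima are over (Borel) measurable functions $\ph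i$.
   Context: $\mathcal{H}^m=\{h\in L^2([0,1]) : D^jh \text{ exists in the weak sense for } j=1,\dots,m \text{ and } D^mh\in L^2([0,1])\}$ is the Sobolev space on $[0,1]$, where $D^jh=h^{(j)}$ is the $j$-th derivative (elements are identified with their continuous representatives, so point evaluations make sense). A boundary conditions operator is a full rank continuous linear operator $B=(B^j)_{j=1}^m:\mathcal{H}^m\to\mathbb{R}^m$ with $\mathrm{Ker}\,B\cap\mathbb{P}^{m-1}=\{0\}$, where $\mathbb{P}^{m-1}=\mathrm{Ker}\,D^m$ is the space of polynomial functions of degree at most $m-1$. $\mathcal{H}^m$ is equipped with the Hilbert space inner product $\langle u,v\rangle_{\mathcal{H}^m}=\int_0^1u^{(m)}(t)v^{(m)}(t)\,dt+\sum_{j=1}^mB^ju\,B^jv$. For $x\in\mathcal{H}^m$ (known through its values on $\tau_d$) the smoothing spline estimate $\widehat{x}_{\lambda,\tau_d}$ is the unique solution of $$\arg\min_{h\in\mathcal{H}^m}\frac{1}{|\tau_d|}\sum_{l=1}^{|\tau_d|}(x(t_l)-h(t_l))^2+\lambda\int_{[0,1]}(h^{(m)}(t))^2\,dt .$$ $\widehat{X}_{\lambda,\tau_d}$ is obtained by applying this to each realization of $X$. *)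

(* Defs.v *)
From HB Require Import structures.
From mathcomp Require Import all_boot all_order all_algebra.
From mathcomp Require Import all_classical all_reals all_analysis.
From mathcomp Require Import measurable_realfun.

Set Implicit Arguments.
Unset Strict Implicit.
Unset Printing Implicit Defensive.

Import Order.TTheory GRing.Theory Num.Theory.
Import numFieldNormedType.Exports.

Local Open Scope classical_set_scope.
Local Open Scope ring_scope.

Section weak_derivatives.
Context {R : realType}.
Implicit Types (h g phi : R -> R) (j m : nat).
Local Notation mu := (@lebesgue_measure R).

(* The space C_c^oo(]0, 1[); a closed subset of R contained in ]0, 1[ is
   compact. *)
Definition test_function phi :=
  (forall j t, derivable (derive1n j phi) t 1) /\
  closure [set t | phi t != 0] `<=` `]0, 1[.

Definition weak_derivative j h g :=
  locally_integrable `]0, 1[ g /\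
  forall phi, test_function phi ->
    \int[mu]_(t in `]0, 1[) (h t * derive1n j phi t) =
    (-1) ^+ j * \int[mu]_(t in `]0, 1[) (g t * phi t).

Definition L2_unit h := (h \_ `[0, 1]) \in Lfun mu 2%:E.

(* A function on [0, 1] is encoded as a function on R that vanishes outside
   [0, 1]; a class of H^m is encoded by its continuous representative. *)
Definition sobolev_set m : set (R -> R) := [set h : R -> R |
  [/\ h \_ `[0, 1] = h,
      {within `[0, 1], continuous h},
      L2_unit h,
      forall j, (1 <= j <= m)%N -> exists g, weak_derivative j h g &
      exists2 g, weak_derivative m h g & L2_unit g]].

Definition sobolev_pred m : {pred R -> R} := mem (sobolev_set m).

(* Weak derivatives are unique up to a negligible set; weakD picks one. *)
Definition weakD j h : R -> R := xget 0 [set g | weak_derivative j h g].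

Lemma locally_integrableM_compact g phi (K : set R) :
  locally_integrable `]0, 1[ g -> continuous phi ->
  compact K -> K `<=` `]0, 1[ -> (forall t, ~ K t -> phi t = 0) ->
  mu.-integrable `]0, 1[ (EFin \o (fun t => g t * phi t)).
Proof.
move=> [mg oI gloc] cphi cK KI phi0.
have mphi : measurable_fun setT phi by exact: continuous_measurable_fun.
have mgphi : measurable_fun (`]0, 1[ : set R) (fun t => g t * phi t).
  by apply: measurable_funM => //; exact: measurable_funTS.
have mK : measurable K by exact: compact_measurable.
have cphiK : {within K, continuous phi} by exact: continuous_subspaceT.
have [M [_ /(_ (`|M| + 1))]] := compact_bounded (continuous_compact cphiK cK).
move=> /(_ (ltr_pwDr ltr01 (ler_norm _)))/= phiM.
have mKg : measurable_fun K (EFin \o (Num.norm \o g)).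
  apply/measurable_EFinP; apply: measurableT_comp => //.
  by apply: (measurable_funS _ KI) mg.
have mKgphi : measurable_fun K (fun t => g t * phi t).
  by apply: (measurable_funS _ KI) mgphi.
have intK : mu.-integrable K (EFin \o (fun t => g t * phi t)).
  apply/integrableP; split; first exact/measurable_EFinP.
  apply: (@le_lt_trans _ _ (\int[mu]_(t in K) ((`|M| + 1)%:E * `|g t|%:E))%E).
    apply: ge0_le_integral => //=.
    - by apply/measurable_EFinP; exact: measurableT_comp.
    - apply/measurable_EFinP; apply: measurable_funM => //.
      exact/measurable_EFinP.
    - move=> t Kt; rewrite lee_fin normrM mulrC ler_wpM2r//.
      by apply: phiM; exists t.
  by rewrite ge0_integralZl//= lte_mul_pinfty// gloc.
apply: (@eq_integrable _ _ _ mu _ _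
    ((EFin \o (fun t => g t * phi t)) \_ K)) => //.
  move=> t _; rewrite /patch; case: ifPn => //= /negP Kt.
  by rewrite phi0 ?mulr0// => /mem_set.
by rewrite -integrable_restrict//= setIidr.
Qed.

Lemma test_function_derive1n0 phi j t : test_function phi ->
  ~ closure [set t | phi t != 0] t -> derive1n j phi t = 0.
Proof.
move=> _; elim: j t => [|j IH] t Kt.
  rewrite derive1n0; apply/eqP/negPn/negP => phit.
  by apply: Kt; exact: subset_closure.
rewrite derive1nS derive1E.
have -> : 'D_1 (derive1n j phi) t = 'D_1 (cst 0 : R -> R) t.
  apply: near_eq_derive.
  near=> s; apply: IH; near: s.
  apply: open_nbhs_nbhs; split => //.
  by apply: closed_openC; exact: closed_closure.
by rewrite derive_cst.
Unshelve. all: by end_near. Qed.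

Lemma test_function_integrable g phi j :
  locally_integrable `]0, 1[ g -> test_function phi ->
  mu.-integrable `]0, 1[ (EFin \o (fun t => g t * derive1n j phi t)).
Proof.
move=> gloc tphi; have [dphi suppphi] := tphi.
apply: (locally_integrableM_compact gloc _ _ suppphi).
- by move=> t; apply/differentiable_continuous/derivable1_diffP/dphi.
- apply: (subclosed_compact _ (@segment_compact _ 0 1)).
    exact: closed_closure.
  by apply: subset_trans suppphi _; exact: subset_itv_oo_cc.
- by move=> t; exact: test_function_derive1n0.
Qed.

Lemma locally_integrable_lin (c : R) g1 g2 :
  locally_integrable `]0, 1[ g1 -> locally_integrable `]0, 1[ g2 ->
  locally_integrable `]0, 1[ (c *: g1 + g2).
Proof.
move=> [m1 oI l1] ig2; apply: locally_integrableD => //; split=> //.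
  exact: measurable_funM.
move=> K KI cK; under eq_integral do rewrite normrM EFinM.
have mK := compact_measurable cK.
rewrite ge0_integralZl//=.
- by rewrite lte_mul_pinfty// l1.
- apply/measurable_EFinP; apply: measurableT_comp => //.
  exact: measurable_funS m1.
Qed.

Lemma within_locally_integrable h :
  {within `[0, 1], continuous h} -> locally_integrable `]0, 1[ h.
Proof.
move=> ch; apply: open_integrable_locally; first exact: interval_open.
apply: (@integrableS _ _ _ mu `[0, 1]) => //.
  exact: subset_itv_oo_cc.
by apply: continuous_compact_integrable => //; exact: segment_compact.
Qed.

Lemma weak_derivative_lin j (c : R) h1 h2 g1 g2 :
  locally_integrable `]0, 1[ h1 -> locally_integrable `]0, 1[ h2 ->
  weak_derivative j h1 g1 -> weak_derivative j h2 g2 ->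
  weak_derivative j (c *: h1 + h2) (c *: g1 + g2).
Proof.
move=> ih1 ih2 [ig1 wg1] [ig2 wg2]; split; first exact: locally_integrable_lin.
move=> phi tphi.
have lin f1 f2 n : locally_integrable `]0, 1[ f1 ->
    locally_integrable `]0, 1[ f2 ->
    \int[mu]_(t in `]0, 1[) ((c *: f1 + f2) t * derive1n n phi t) =
    c * \int[mu]_(t in `]0, 1[) (f1 t * derive1n n phi t) +
    \int[mu]_(t in `]0, 1[) (f2 t * derive1n n phi t).
  move=> if1 if2.
  have i1 := test_function_integrable n if1 tphi.
  have i2 := test_function_integrable n if2 tphi.
  rewrite -RintegralZl// -RintegralD//.
    by apply: eq_Rintegral => t _; rewrite /= mulrDl mulrA.
  by have := integrableZl _ c i1; exact.
rewrite lin// wg1// wg2// (lin _ _ 0%N)//=.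
by rewrite mulrDr mulrCA.
Qed.

Lemma L2_unit_lin (c : R) h1 h2 :
  L2_unit h1 -> L2_unit h2 -> L2_unit (c *: h1 + h2).
Proof.
rewrite /L2_unit => l1 l2.
rewrite (_ : _ \_ _ = c *: (h1 \_ `[0, 1]) + h2 \_ `[0, 1]); last first.
  apply/funext => t.
  rewrite -[RHS]/(c * (h1 \_ `[0, 1]) t + (h2 \_ `[0, 1]) t) /patch.
  by case: ifPn => // _; rewrite mulr0 addr0.
have [_ cl] := @Lfun_submod_closed _ _ R mu 2%:E (lee1n 2).
by have := cl c _ _ l1 l2.
Qed.

Lemma sobolev_submod_closed m : submod_closed (sobolev_pred m).
Proof.
have loc0 : locally_integrable `]0, 1[ (0 : R -> R).
  by apply: within_locally_integrable; exact: cst_continuous.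
have wd0 j : weak_derivative j (0 : R -> R) 0.
  split => // phi _.
  have int0 (f : R -> R) : \int[mu]_(t in `]0, 1[) ((0 : R -> R) t * f t) = 0.
    under eq_Rintegral do rewrite /= mul0r.
    by rewrite Rintegral_cst// mul0r.
  by rewrite !int0 mulr0.
have l20 : L2_unit (0 : R -> R).
  rewrite /L2_unit (_ : _ \_ _ = 0); first by have [] :=
    @Lfun_submod_closed _ _ R mu 2%:E (lee1n 2).
  by apply/funext => t; rewrite /patch; case: ifP.
split.
  apply/mem_set; split => //.
  - by apply/funext => t; rewrite /patch; case: ifP.
  - exact: cst_continuous.
  - by move=> j _; exists 0.
  - by exists 0.
move=> c h1 h2 /set_mem[p1 c1 l1 w1 [g1 wg1 lg1]].
move=> /set_mem[p2 c2 l2 w2 [g2 wg2 lg2]]; apply/mem_set.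
have i1 := within_locally_integrable c1.
have i2 := within_locally_integrable c2.
split.
- apply/funext => t; have := congr1 (@^~ t) p1; have := congr1 (@^~ t) p2.
  rewrite /patch; case: ifPn => // _ h2t h1t.
  by rewrite -[RHS]/(c * h1 t + h2 t) -h1t -h2t mulr0 addr0.
- by move=> t; apply: cvgD; [apply: cvgZr; exact: c1|exact: c2].
- exact: L2_unit_lin.
- move=> j jm; have [f1 wf1] := w1 j jm; have [f2 wf2] := w2 j jm.
  by exists (c *: f1 + f2); exact: weak_derivative_lin.
- by exists (c *: g1 + g2); [exact: weak_derivative_lin|exact: L2_unit_lin].
Qed.

End weak_derivatives.

HB.instance Definition _ (R : realType) (m : nat) :=
  GRing.isSubmodClosed.Build R (R -> R) (@sobolev_pred R m)
    (sobolev_submod_closed m).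

Record sobolev (R : realType) (m : nat) := Sobolev {
  sobolev_fun :> R -> R;
  sobolev_funP : sobolev_fun \in @sobolev_pred R m }.

HB.instance Definition _ (R : realType) (m : nat) :=
  [isSub for @sobolev_fun R m].
HB.instance Definition _ (R : realType) (m : nat) :=
  [Choice of sobolev R m by <:].
HB.instance Definition _ (R : realType) (m : nat) :=
  [SubChoice_isSubLmodule of sobolev R m by <:].
HB.instance Definition _ (R : realType) (m : nat) :=
  isPointed.Build (sobolev R m) 0.

Section dist_open.
Context {R : realType} {V : zmodType} (N : V -> R).

(* The open sets of V for the distance N (v - u), where N is a norm. *)
Definition dist_open : set_system V := [set U |
  forall u, U u -> exists2 e : R, 0 < e & forall v, N (v - u) < e -> U v].

Lemma dist_openT : dist_open setT.
Proof. by move=> u _; exists 1. Qed.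

Lemma dist_openI : setI_closed dist_open.
Proof.
move=> A B oA oB u [/oA[e1 e1_gt0 Ae1] /oB[e2 e2_gt0 Be2]].
exists (Num.min e1 e2); first by rewrite lt_min e1_gt0.
by move=> v; rewrite lt_min => /andP[/Ae1 ? /Be2 ?].
Qed.

Lemma dist_open_bigU (I : Type) (f : I -> set V) :
  (forall i, dist_open (f i)) -> dist_open (\bigcup_i f i).
Proof.
move=> of_ u [i _ /of_[e e_gt0 fe]].
by exists e => // v /fe; exists i.
Qed.

End dist_open.

Section sobolev_space.
Context {R : realType} {m : nat}.
Local Notation mu := (@lebesgue_measure R).

Definition sobolev_norm (u : sobolev R m) : R :=
  Num.sqrt (\int[mu]_(t in `[0, 1]) (u t ^+ 2) +
    \sum_(1 <= j < m.+1) \int[mu]_(t in `[0, 1]) (weakD j u t ^+ 2)).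

HB.instance Definition _ := isOpenTopological.Build (sobolev R m)
  (dist_openT sobolev_norm) (dist_openI (N := sobolev_norm))
  (dist_open_bigU (N := sobolev_norm)).

Definition is_polynomial (u : sobolev R m) :=
  exists2 p : {poly R}, (size p <= m)%N & forall t, t \in `[0, 1] -> u t = p.[t].

(* Continuity is for the topology of the usual norm [sobolev_norm]. *)
Definition boundary_operator (B : {linear sobolev R m -> 'rV[R]_m}) :=
  [/\ continuous B, range B = setT &
      forall u, B u = 0 -> is_polynomial u -> u = 0].

Definition inner (B : sobolev R m -> 'rV[R]_m) (u v : sobolev R m) : R :=
  \int[mu]_(t in `[0, 1]) (weakD m u t * weakD m v t) +
  \sum_(j < m) B u 0 j * B v 0 j.

Definition inner_norm B (u : sobolev R m) : R := Num.sqrt (inner B u u).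

End sobolev_space.

(* H^m with the topology induced by [inner B]. *)
Definition hilbert (R : realType) (m : nat) (B : sobolev R m -> 'rV[R]_m) : Type
  := sobolev R m.

HB.instance Definition _ (R : realType) (m : nat)
  (B : sobolev R m -> 'rV[R]_m) := Pointed.on (hilbert B).

HB.instance Definition _ (R : realType) (m : nat)
  (B : sobolev R m -> 'rV[R]_m) := GRing.Lmodule.on (hilbert B).

HB.instance Definition _ (R : realType) (m : nat)
    (B : sobolev R m -> 'rV[R]_m) := isOpenTopological.Build (hilbert B)
  (dist_openT (inner_norm B)) (dist_openI (N := inner_norm B))
  (dist_open_bigU (N := inner_norm B)).

Notation borel_hilbert B := (g_sigma_algebraType (@open (hilbert B))).

Section smoothing_spline.
Context {R : realType} {m n : nat}.
Implicit Types (tau : n.-tuple R) (x h : sobolev R m).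
Local Notation mu := (@lebesgue_measure R).

Definition sampling tau x : n.-tuple R := [tuple x (tnth tau l) | l < n].

(* No nontrivial linear combination of the B^j and the evaluations vanishes. *)
Definition independent_from_evaluations (B : sobolev R m -> 'rV[R]_m) tau :=
  forall (a : 'I_m -> R) (b : 'I_n -> R),
    (forall h, \sum_(j < m) a j * B h 0 j +
               \sum_(l < n) b l * h (tnth tau l) = 0) ->
    (forall j, a j = 0) /\ (forall l, b l = 0).

Definition penalized_criterion (lambda : R) tau x h : R :=
  n%:R^-1 * \sum_(l < n) (x (tnth tau l) - h (tnth tau l)) ^+ 2 +
  lambda * \int[mu]_(t in `[0, 1]) (weakD m h t ^+ 2).

(* The minimizer exists and is unique for at least m distinct points of [0, 1]
   and lambda > 0; 0 is only the default value of xget. *)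
Definition smoothing_spline (lambda : R) tau x : sobolev R m :=
  xget 0 [set h | forall g,
    penalized_criterion lambda tau x h <= penalized_criterion lambda tau x g].

End smoothing_spline.

Section optimal_risks.
Context {R : realType} {d d' : measure_display}.
Context {Omega : measurableType d} {Z : measurableType d'}.
Context (P : probability Omega R) (X : Omega -> Z) (Y : Omega -> R).

Definition bayes_error : \bar R :=
  ereal_inf [set P [set w | phi (X w) != Y w] | phi in
    [set phi : {mfun Z >-> R} | forall z, phi z = -1 \/ phi z = 1]].

Definition bayes_mse : \bar R :=
  ereal_inf [set ('E_P[fun w => ((phi (X w) - Y w) ^+ 2)%R])%E | phi in
    [set: {mfun Z >-> R}]].

End optimal_risks.

(* Main.v *)
Require Import Defs.
From HB Require Import structures.
From mathcomp Require Import all_boot all_order all_algebra.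
From mathcomp Require Import all_classical all_reals all_analysis.
From mathcomp Require Import measurable_realfun qpoly.
From mathcomp Require Import ring lra.
Import Order.TTheory GRing.Theory Num.Theory.
Import numFieldNormedType.Exports.
Local Open Scope classical_set_scope.
Local Open Scope ring_scope.
Set Implicit Arguments.
Unset Strict Implicit.
Unset Printing Implicit Defensive.

(** The smoothing spline of a function depends only on the sampled values of
    that function, and conversely these values can be recovered measurably
    from the smoothing spline. A classifier or a regression function of one of
    the two observations is therefore the composition of a measurable map with
    such a function of the other, so that both observations have the same
    optimal risks ([bayes_error_comp], [bayes_mse_comp]). What has to be found
    is a pair of measurable maps [S] from samples to splines and [T] from [H^m]
    to samples ([smoothing_spline_equivalence]).

    The analytic input is [divided_difference]: if the combination
    [\sum_i c i * p (x i)] vanishes for all polynomials [p] of degree less than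
    [m], then for [u] in [H^m] the number [\sum_i c i * u (x i)] is, up to the
    factor [(m - 1)!], the integral of [u^(m)] against the kernel
    [\sum_i c i * (x i - s)_+ ^ (m - 1)]. It follows from the definition of weak
    derivatives by smoothing this kernel into test functions
    ([smooth_kernel]): their [m]-th derivatives are approximate Dirac masses at
    the points [x i]. The case [m = 1] of the same approximation yields the
    fundamental lemma of the calculus of variations, hence the uniqueness of
    weak derivatives ([weak_derivative_unique]). Two consequences are used. The
    functions of [H^m] with vanishing [m]-th derivative are polynomials
    ([semi_eq0_polynomial]), by Lagrange interpolation. And splines of degree
    [2 m - 1] represent the divided differences for the semi-inner product
    [semi] of [H^m] ([semi_spline]).

    The normal equation of the penalized least squares problem then becomes a
    square linear system for the coefficients of a spline. The system is
    injective because [semi] is nonnegative and because a polynomial of degree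
    less than [m] with [n >= m] distinct roots is zero. Hence the minimizer
    exists, is unique, and is a linear function [S] of the sample
    ([smoothing_spline_linear]).

    A linear map on a finite-dimensional space is continuous for the norm of
    [inner B], so [S] is measurable ([measurable_linear]). If [S y = 0], then by
    the normal equation [\sum_l y l * g (t l) = 0] for all [g] in [H^m], so that
    [y = 0] by the independence of the evaluations. As [inner B] is definite,
    the Gram matrix of the images under [S] of the canonical basis is
    invertible; multiplying the vector of the inner products with these images
    by its inverse is a continuous left inverse [T] of [S]
    ([linear_left_inverse]). *)

(** * Smooth functions *)

Section smooth_functions.
Context {R : realType}.
Implicit Types (f g : R -> R) (k : nat).

(** [k]-fold differentiability on the whole line. *)
Fixpoint differentiable_n k f : Prop :=
  if k is k'.+1 then
    (forall t, derivable f t 1) /\ differentiable_n k' f^`()%classic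
  else True.

(** Functions with derivatives of all orders on the whole line. *)
Definition smooth f := forall k, differentiable_n k f.

Lemma smooth_derive1n f : smooth f ->
  forall j t, derivable (derive1n j f) t 1.
Proof.
move=> sf j; have := sf j.+1; elim: j f {sf} => [|j IH] f.
  by case=> + _ t; apply.
by move=> [_ fj] t; rewrite derive1Sn; exact: IH.
Qed.

Lemma smooth_derivable f t : smooth f -> derivable f t 1.
Proof. by move=> /(_ 1%N)[]. Qed.

Lemma smooth_derive1 f : smooth f -> smooth f^`()%classic.
Proof. by move=> sf k; have [] := sf k.+1. Qed.

Lemma smooth_derive1n_smooth f j : smooth f -> smooth (derive1n j f).
Proof. by move=> sf; elim: j => //= j; exact: smooth_derive1. Qed.

Lemma derivable1_continuous f : (forall t, derivable f t 1) -> continuous f.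
Proof.
by move=> df t; apply/differentiable_continuous/derivable1_diffP.
Qed.

Lemma smooth_continuous f : smooth f -> continuous f.
Proof.
by move=> sf; apply: derivable1_continuous => t; exact: smooth_derivable.
Qed.

Lemma differentiable_nW k f : differentiable_n k.+1 f -> differentiable_n k f.
Proof. by elim: k f => //= k IH f [df /IH]. Qed.

Lemma differentiable_nD k f g :
  differentiable_n k f -> differentiable_n k g -> differentiable_n k (f \+ g).
Proof.
elim: k f g => //= k IH f g [df fk] [dg gk]; split.
  by move=> t; apply: derivableD.
rewrite (_ : _^`()%classic = f^`()%classic \+ g^`()%classic); first exact: IH.
by apply/funext => t; rewrite /= !derive1E deriveD.
Qed.

Lemma differentiable_nN k f :
  differentiable_n k f -> differentiable_n k (\- f).
Proof.
elim: k f => //= k IH f [df fk]; split.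
  by move=> t; apply: derivableN.
rewrite (_ : _^`()%classic = \- f^`()%classic); first exact: IH.
by apply/funext => t; rewrite /= !derive1E deriveN.
Qed.

Lemma differentiable_nM k f g :
  differentiable_n k f -> differentiable_n k g -> differentiable_n k (f \* g).
Proof.
elim: k f g => //= k IH f g [df fk] [dg gk]; split.
  by move=> t; apply: derivableM.
rewrite (_ : _^`()%classic = (f^`()%classic \* g) \+ (f \* g^`()%classic)).
  by apply: differentiable_nD; apply: IH => //; exact: differentiable_nW.
apply/funext => t; rewrite /= !derive1E deriveM// addrC.
by congr (_ + _); rewrite -[LHS]/(_ * _) mulrC.
Qed.

Lemma differentiable_nV k f : (forall t, f t != 0) ->
  differentiable_n k f -> differentiable_n k (fun t => (f t)^-1).
Proof.
move=> f0; elim: k => //= k IH [df fk]; split.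
  by move=> t; apply: derivableV.
have fk' := IH (@differentiable_nW k f (conj df fk)).
rewrite (_ : _^`()%classic =
    \- (f^`()%classic \* ((fun t => (f t)^-1) \* (fun t => (f t)^-1)))).
  by apply: differentiable_nN; do 2 apply: differentiable_nM => //.
apply/funext => t; rewrite /= !derive1E deriveV//.
by rewrite -[LHS]/(_ * _) /= mulNr mulrC -expr2 exprVn.
Qed.

Lemma smoothD f g : smooth f -> smooth g -> smooth (f \+ g).
Proof. by move=> sf sg k; apply: differentiable_nD. Qed.

Lemma smoothM f g : smooth f -> smooth g -> smooth (f \* g).
Proof. by move=> sf sg k; apply: differentiable_nM. Qed.

Lemma smoothV f : (forall t, f t != 0) -> smooth f ->
  smooth (fun t => (f t)^-1).
Proof. by move=> f0 sf k; apply: differentiable_nV. Qed.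

Lemma smooth_horner (p : {poly R}) : smooth (horner p).
Proof.
move=> k; elim: k p => //= k IH p; split; first exact: derivable_horner.
by rewrite -derivE.
Qed.

Lemma smooth_cst (c : R) : smooth (cst c).
Proof. by rewrite -hornerC_ext; exact: smooth_horner. Qed.

Lemma derive1_affine f (a b t : R) : derivable f (a * t + b) 1 ->
  derivable (fun s => f (a * s + b)) t 1 /\
  (fun s => f (a * s + b))^`()%classic t = a * f^`()%classic (a * t + b).
Proof.
move=> df; pose g (s : R) := a * s + b.
have dg : is_derive t (1 : R) g a.
  apply: is_derive_eq; rewrite addr0 -[LHS]/(a * 1).
  exact: mulr1.
have df' : is_derive (g t) (1 : R) f ('D_1 f (g t)) by exact/derivableP.
have d := is_derive1_comp df' dg.
split; first exact: (@ex_derive _ _ _ _ _ _ _ d).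
rewrite derive1E mulrC derive1E.
exact: (@derive_val _ _ _ _ _ _ _ d).
Qed.

Lemma smooth_affine f (a b : R) : smooth f -> smooth (fun s => f (a * s + b)).
Proof.
move=> sf k; elim: k f sf => //= k IH f sf.
split=> [t|]; first by apply: (derive1_affine _).1; exact: smooth_derivable.
rewrite (_ : _^`()%classic =
    cst a \* (fun s => f^`()%classic (a * s + b))); last first.
  by apply/funext=> t; rewrite (derive1_affine _).2//; exact: smooth_derivable.
apply: differentiable_nM; first exact: smooth_cst.
by apply: IH; exact: smooth_derive1.
Qed.

Lemma derive1n_affine f (a b : R) j t : smooth f ->
  derive1n j (fun s => f (a * s + b)) t = a ^+ j * derive1n j f (a * t + b).
Proof.
move=> sf; elim: j t => [|j IH] t; first by rewrite mul1r.
rewrite !derive1nS (_ : derive1n j _ =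
  (fun s => a ^+ j * (fun r => derive1n j f (a * r + b)) s)); last exact/funext.
have dj := @smooth_derive1n f sf j.
have [d1 d2] := derive1_affine (dj (a * t + b)).
by rewrite (derive1Ml _ d1) d2 mulrA -exprSr.
Qed.

Lemma derive1n_eq0 f j (U : set R) t : open U -> U t ->
  (forall s, U s -> f s = 0) -> derive1n j f t = 0.
Proof.
move=> oU; elim: j t => [|j IH] t Ut f0; first exact: f0.
rewrite derive1nS derive1E.
have -> : 'D_1 (derive1n j f) t = 'D_1 (cst 0 : R -> R) t.
  apply: near_eq_derive.
  by near=> s; apply: IH => //; near: s; exact: open_nbhs_nbhs.
by rewrite derive_cst.
Unshelve. all: by end_near. Qed.

Lemma derive1n_near_eq f g j (U : set R) t : open U -> U t ->
  (forall s, U s -> f s = g s) -> derive1n j f t = derive1n j g t.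
Proof.
move=> oU; elim: j t => [|j IH] t Ut fg; first exact: fg.
rewrite !derive1nS !derive1E; apply: near_eq_derive.
by near=> s; apply: IH => //; near: s; exact: open_nbhs_nbhs.
Unshelve. all: by end_near. Qed.

Lemma derive1nD f g j : smooth f -> smooth g ->
  derive1n j (f \+ g) = derive1n j f \+ derive1n j g.
Proof.
move=> sf sg; elim: j => // j IH; rewrite !derive1nS IH.
apply/funext => t; rewrite /= !derive1E.
by apply: deriveD; exact: smooth_derive1n.
Qed.

Lemma derive1nZ f (c : R) j : smooth f ->
  derive1n j (cst c \* f) = cst c \* derive1n j f.
Proof.
move=> sf; elim: j => // j IH; rewrite !derive1nS IH.
apply/funext => t; apply: (@derive1Ml _ (derive1n j f) t c).
exact: smooth_derive1n.
Qed.

Lemma smooth_sum (I : Type) (s : seq I) (f : I -> R -> R) :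
  (forall i, smooth (f i)) -> smooth (fun t => \sum_(i <- s) f i t).
Proof.
move=> sf; elim: s => [|i s IH].
  rewrite (_ : (fun _ => _) = cst 0); first exact: smooth_cst.
  by apply/funext => t; rewrite big_nil.
rewrite (_ : (fun _ => _) = f i \+ (fun t => \sum_(i <- s) f i t)).
  exact: smoothD.
by apply/funext => t; rewrite big_cons.
Qed.

Lemma derive1n_sum (I : Type) (s : seq I) (f : I -> R -> R) j t :
  (forall i, smooth (f i)) ->
  derive1n j (fun t => \sum_(i <- s) f i t) t =
  \sum_(i <- s) derive1n j (f i) t.
Proof.
move=> sf; elim: s => [|i s IH].
  rewrite big_nil; apply: (@derive1n_eq0 _ _ setT) => //; first exact: openT.
  by move=> ? _; rewrite big_nil.
rewrite (_ : (fun _ => _) = f i \+ (fun t => \sum_(i <- s) f i t)); last first.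
  by apply/funext => r; rewrite big_cons.
by rewrite derive1nD//= ?big_cons ?IH//; exact: smooth_sum.
Qed.

Lemma derive1n_horner (p : {poly R}) j t : derive1n j (horner p) t = p^`(j).[t].
Proof.
elim: j p t => [|j IH] p t; first by rewrite derivn0.
by rewrite derive1Sn -derivE IH -derivSn.
Qed.

End smooth_functions.

(** * A smooth step *)

Section smooth_step.
Context {R : realType}.
Implicit Types (p : {poly R}) (x : R).

(** The function [p(1/x) exp(-1/x)], extended by [0] to [x <= 0]. These
    functions form a class that is stable under differentiation. *)
Definition flat p x : R := if 0 < x then p.[x^-1] * expR (- x^-1) else 0.

Lemma flat_bound p :
  exists2 C : R, 0 <= C & forall x, `|flat p x| <= C * x ^+ 2.
Proof.
pose C : R := \sum_(i < size p) `|p`_i| * (i.+2)`!%:R.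
have C0 : 0 <= C by apply: sumr_ge0 => i _; apply: mulr_ge0.
exists C => // x; rewrite /flat; case: ifPn => [x0|_]; last first.
  by rewrite normr0 mulr_ge0// sqr_ge0.
set y := x^-1; have y0 : 0 < y by rewrite invr_gt0.
have xy : x = y^-1 by rewrite invrK.
clearbody y.
rewrite normrM (ger0_norm (expR_ge0 _)) horner_coef.
rewrite (@le_trans _ _ ((\sum_(i < size p) `|p`_i| * y ^+ i) * expR (- y)))//.
  rewrite ler_wpM2r ?expR_ge0//.
  apply: le_trans (ler_norm_sum _ _ _) _; apply: ler_sum => i _.
  by rewrite normrM normrX (gtr0_norm y0).
rewrite mulr_suml mulr_suml; apply: ler_sum => i _.
rewrite -!mulrA ler_wpM2l// expRN xy exprVn.
rewrite ler_pdivlMr ?exprn_gt0//.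
rewrite mulrAC -exprD addn2 ler_pdivrMr ?expR_gt0//.
rewrite mulrC -ler_pdivrMr ?ltr0n ?fact_gt0//.
by apply: le_trans (expR_ge1Dxn i.+1 (ltW y0)); rewrite lerDr.
Qed.

Lemma is_derive_quadratic (f : R -> R) (C : R) : 0 <= C ->
  (forall x, `|f x| <= C * x ^+ 2) -> is_derive (0 : R) (1 : R) f 0.
Proof.
move=> C0 fC.
have f0 : f 0 = 0.
  by apply/normr0_eq0/eqP; rewrite eq_le normr_ge0 andbT (le_trans (fC 0))//
    expr0n mulr0.
have cv : h^-1 *: ((f \o shift 0) (h *: 1) - f 0) @[h --> 0^'] --> (0 : R).
  apply/cvgrPdist_le => e e0; near=> h.
  have h0 : h != 0 by near: h; exact: nbhs_dnbhs_neq.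
  rewrite sub0r normrN /= addr0 f0 subr0 [h *: 1]mulr1 normrM normfV.
  rewrite ler_pdivrMl ?normr_gt0//.
  apply: le_trans (fC h) _; rewrite -[h ^+ 2]ger0_norm ?sqr_ge0// normrX expr2.
  rewrite mulrCA ler_wpM2l//.
  rewrite (@le_trans _ _ ((C + 1) * `|h|))//.
    by rewrite ler_wpM2r// lerDl.
  rewrite -ler_pdivlMl ?ltr_wpDl// mulrC.
  near: h; apply: dnbhs0_le; rewrite divr_gt0// ltr_wpDl//.
split; first by apply/cvg_ex; exists 0.
exact/cvg_lim.
Unshelve. all: by end_near. Qed.

Lemma is_derive_flat p x : is_derive x 1 (flat p) (flat ('X^2 * (p - p^`())) x).
Proof.
have [x0|x0|->] := ltgtP x 0.
- rewrite [X in is_derive _ _ _ X](_ : _ = 0); last first.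
    by rewrite /flat ltNge (ltW x0).
  apply: (@near_eq_is_derive _ _ _ (cst 0)).
  near=> y; rewrite /flat ltNge ifF//; apply/negbF; apply: ltW.
  by near: y; exact: lt_nbhsl.
- rewrite {2}/flat x0.
  apply: (@near_eq_is_derive _ _ _
    ((horner p \o (fun y => y^-1)) * (expR \o (fun y : R => - y^-1)))).
    near=> y; rewrite /flat ifT//; near: y; exact: lt_nbhsr.
  have dV : is_derive x 1 (fun y : R => y^-1) (- x ^- 2).
    have did : derivable (fun y : R => y) x (1 : R) by exact: derivable_id.
    have xn0 : x != 0 by rewrite gt_eqF.
    split; first exact: (derivableV xn0 did).
    by rewrite (deriveV xn0 did) derive_id [LHS]mulr1.
  have dNV : is_derive x 1 (fun y : R => - y^-1) (x ^- 2).
    by have := is_deriveN dV; rewrite opprK.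
  have d1 := is_derive1_comp (is_derive_poly p x^-1) dV.
  have d2 := @is_derive1_comp _ expR (fun y : R => - y^-1) x _ _
    (is_derive_expR (- x^-1)) dNV.
  apply: is_derive_eq (is_deriveM d1 d2) _.
  rewrite -[LHS]/(p.[x^-1] * (expR (- x^-1) * x ^- 2) +
    expR (- x^-1) * (p^`().[x^-1] * - x ^- 2)).
  by rewrite hornerM hornerXn hornerD hornerN -!exprVn; ring.
- rewrite [X in is_derive _ _ _ X](_ : _ = 0); last by rewrite /flat ltxx.
  have [C C0 fC] := flat_bound p.
  exact: is_derive_quadratic fC.
Unshelve. all: by end_near. Qed.

Lemma smooth_flat p : smooth (flat p).
Proof.
move=> k; elim: k p => //= k IH p; split.
  by move=> t; have := is_derive_flat p t; case.
rewrite (_ : _^`()%classic = flat ('X^2 * (p - p^`()))); first exact: IH.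
by apply/funext => t; rewrite derive1E; have := is_derive_flat p t; case.
Qed.

Lemma flat1_ge0 x : 0 <= flat 1 x.
Proof. by rewrite /flat; case: ifP => // _; rewrite hornerC mul1r expR_ge0. Qed.

Lemma flat1_gt0 x : 0 < x -> 0 < flat 1 x.
Proof. by rewrite /flat => ->; rewrite hornerC mul1r expR_gt0. Qed.

Lemma flat_le0 p x : x <= 0 -> flat p x = 0.
Proof. by rewrite /flat ltNge => ->. Qed.

(** A smooth transition from [0] for [x <= 0] to [1] for [x >= 1]. *)
Definition step x : R := flat 1 x * (flat 1 x + flat 1 (1 - x))^-1.

Let step_den_gt0 x : 0 < flat 1 x + flat 1 (1 - x).
Proof.
have [x0|x0] := ltP 0 x.
  by rewrite ltr_pwDl ?flat1_gt0 ?flat1_ge0.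
by rewrite ltr_wpDl ?flat1_ge0// flat1_gt0// subr_gt0 (le_lt_trans x0).
Qed.

Lemma smooth_step : smooth step.
Proof.
apply: smoothM; first exact: smooth_flat.
apply: smoothV; first by move=> t; rewrite gt_eqF// step_den_gt0.
apply: smoothD; first exact: smooth_flat.
rewrite (_ : (fun x => _) = (fun x => flat 1 (-1 * x + 1))).
  by apply: smooth_affine; exact: smooth_flat.
by apply/funext => x; rewrite mulN1r addrC.
Qed.

Lemma step_le0 x : x <= 0 -> step x = 0.
Proof. by move=> x0; rewrite /step flat_le0// mul0r. Qed.

Lemma step_ge1 x : 1 <= x -> step x = 1.
Proof.
move=> x1; rewrite /step [flat 1 (1 - x)]flat_le0 ?subr_le0// addr0 mulfV//.
by rewrite gt_eqF// flat1_gt0// (lt_le_trans ltr01).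
Qed.

Lemma normr_step_le1 x : `|step x| <= 1.
Proof.
rewrite ger0_norm /step.
  by rewrite ler_pdivrMr ?step_den_gt0// mul1r lerDl flat1_ge0.
by rewrite mulr_ge0 ?flat1_ge0// invr_ge0 ltW ?step_den_gt0.
Qed.

End smooth_step.

(** * Smooth approximations of spline kernels *)

Section spline_kernels.
Context {R : realType}.
Implicit Types (a s e x : R) (r m : nat).
Local Notation mu := (@lebesgue_measure R).

(** The polynomial [p] cut off outside [[0, a]]. *)
Definition cutoff a (p : {poly R}) s : R := if 0 <= s <= a then p.[s] else 0.

(** A smooth version of the truncated power: [0] for [y <= 0] and [y ^ r] for
    [y >= 1]. *)
Definition smooth_power r (y : R) : R := y ^+ r * step y.

Lemma smooth_smooth_power r : smooth (smooth_power r).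
Proof.
rewrite (_ : smooth_power r = horner 'X^r \* step).
  by apply: smoothM; [exact: smooth_horner|exact: smooth_step].
by apply/funext => y; rewrite /= hornerXn.
Qed.

Lemma derive1n_smooth_power_lt0 r j y : y < 0 ->
  derive1n j (smooth_power r) y = 0.
Proof.
move=> y0; apply: (@derive1n_eq0 _ _ _ `]-oo, 0[).
- exact: interval_open.
- by rewrite /= in_itv/= y0.
- move=> s; rewrite /= in_itv/= => s0.
  by rewrite /smooth_power step_le0 ?mulr0 ?ltW.
Qed.

Lemma derive1n_smooth_power_gt1 r j y : 1 < y ->
  derive1n j (smooth_power r) y = ('X^r)^`(j).[y].
Proof.
move=> y1; rewrite -derive1n_horner.
apply: (@derive1n_near_eq _ _ _ _ `]1, +oo[).
- exact: interval_open.
- by rewrite /= in_itv/= y1.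
- move=> s; rewrite /= in_itv/= andbT => s1.
  by rewrite /smooth_power step_ge1 ?mulr1 ?hornerXn ?ltW.
Qed.

Lemma derive1n_smooth_power_r r y : 1 < y ->
  derive1n r (smooth_power r) y = r`!%:R.
Proof.
move=> y1; rewrite derive1n_smooth_power_gt1// derivnXn ffactnn subnn expr0.
by rewrite hornerMn hornerC.
Qed.

Lemma derive1n_smooth_power_rS r y : y < 0 \/ 1 < y ->
  derive1n r.+1 (smooth_power r) y = 0.
Proof.
case=> y1; first exact: derive1n_smooth_power_lt0.
by rewrite derive1n_smooth_power_gt1// derivnXn ffact_small// mulr0n horner0.
Qed.

Lemma derive1n_smooth_power_bounded r :
  exists2 M : R, 0 <= M & forall y, `|derive1n r.+1 (smooth_power r) y| <= M.
Proof.
set g := derive1n r.+1 _.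
have cg : {within `[0, 1], continuous g}.
  apply: continuous_subspaceT; apply: smooth_continuous.
  exact/smooth_derive1n_smooth/smooth_smooth_power.
have := compact_bounded (continuous_compact cg (@segment_compact _ 0 1)).
move=> [M [_ /(_ (`|M| + 1))]].
move=> /(_ (ltr_pwDr ltr01 (ler_norm _)))/= gM.
exists (`|M| + 1) => [|y]; first by rewrite addr_ge0.
have [y0|y0] := ltP y 0.
  by rewrite /g derive1n_smooth_power_rS ?normr0 ?addr_ge0//; left.
have [y1|y1] := ltP 1 y.
  by rewrite /g derive1n_smooth_power_rS ?normr0 ?addr_ge0//; right.
by apply: gM; exists y => //=; rewrite in_itv/= y0.
Qed.

(** A map from [[0, 1]] to [[2 e, 1 - e]] that is close to the identity,
    for [0 <= e <= 1/4]. Moving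
    the nodes by it leaves room inside [[0, 1]] for the supports of the smoothed
    kernels, and it is affine, so that it preserves [annihilates]. *)
Definition shrink e x : R := 2 * e + (1 - 3 * e) * x.

Lemma shrink_bounds e x : 0 <= e <= 4^-1 -> 0 <= x <= 1 ->
  2 * e <= shrink e x <= 1 - e.
Proof.
by rewrite /shrink => /andP[e0 e4] /andP[x0 x1]; apply/andP; split; nra.
Qed.

Lemma shrink_dist e x : 0 <= e -> 0 <= x <= 1 -> `|shrink e x - x| <= 2 * e.
Proof.
rewrite /shrink => e0 /andP[x0 x1].
by rewrite ler_norml; apply/andP; split; nra.
Qed.

(** A smooth approximation of the kernel [\sum_i c i * (x i - s)_+ ^ r]. The
    form with [smooth_power] makes the derivatives easy to compute;
    [smooth_kernelE] is the form used for estimates. *)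
Definition smooth_kernel r N (c x : 'I_N -> R) e s : R :=
  \sum_(i < N)
    c i * (e ^+ r * smooth_power r (- e^-1 * s + shrink e (x i) / e)).

(** The combination of the evaluations at the points [x i] with weights [c i]
    is zero on the polynomials of degree less than [m]. *)
Definition annihilates m N (c x : 'I_N -> R) :=
  forall p : {poly R}, (size p <= m)%N -> \sum_(i < N) c i * p.[x i] = 0.

Lemma smooth_kernelE r N (c x : 'I_N -> R) e s : 0 < e ->
  smooth_kernel r c x e s = \sum_(i < N)
    c i * ((shrink e (x i) - s) ^+ r * step ((shrink e (x i) - s) / e)).
Proof.
move=> e0; apply: eq_bigr => i _; rewrite /smooth_power.
rewrite (_ : - e^-1 * s + _ = (shrink e (x i) - s) / e); last by ring.
congr (_ * _); rewrite mulrA; congr (_ * _).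
by rewrite -exprMn mulrCA mulfV ?gt_eqF// mulr1.
Qed.

Lemma normr_smooth_kernel r N (c x : 'I_N -> R) e s :
  0 < e <= 4^-1 -> (forall i, 0 <= x i <= 1) -> 0 <= s <= 1 ->
  `|smooth_kernel r c x e s| <= \sum_(i < N) `|c i|.
Proof.
move=> /andP[e0 e4] x01 /andP[s0 s1]; rewrite smooth_kernelE//.
apply: le_trans (ler_norm_sum _ _ _) _; apply: ler_sum => i _.
rewrite normrM -[leRHS]mulr1 ler_wpM2l// normrM -[leRHS]mulr1.
rewrite ler_pM ?normr_step_le1//.
rewrite normrX exprn_ile1//.
have /andP[y0 y1] : 2 * e <= shrink e (x i) <= 1 - e.
  by apply: shrink_bounds => //; rewrite ltW.
by rewrite ler_norml; apply/andP; split; lra.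
Qed.

Let smooth_kernel_term r e (y : R) :
  smooth (fun s => e ^+ r * smooth_power r (- e^-1 * s + y)).
Proof.
apply: (@smoothM _ (cst (e ^+ r)) (fun s => smooth_power r (- e^-1 * s + y))).
  exact: smooth_cst.
by apply: smooth_affine; exact: smooth_smooth_power.
Qed.

Let smooth_kernel_term' r e (c y : R) :
  smooth (fun s => c * (e ^+ r * smooth_power r (- e^-1 * s + y))).
Proof.
apply: (@smoothM _ (cst c)); first exact: smooth_cst.
exact: smooth_kernel_term.
Qed.

Lemma smooth_smooth_kernel r N (c x : 'I_N -> R) e :
  smooth (smooth_kernel r c x e).
Proof.
by apply: smooth_sum => i; exact: smooth_kernel_term'.
Qed.

(** To the right of all nodes the kernel is [0]; to the left of all of them it
    is a combination of the values of a polynomial of degree [r] at the nodes,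
    which also is [0]. *)
Lemma test_function_smooth_kernel r N (c x : 'I_N -> R) e :
  0 < e <= 4^-1 -> (forall i, 0 <= x i <= 1) -> annihilates r.+1 c x ->
  test_function (smooth_kernel r c x e).
Proof.
move=> /[dup] e04 /andP[e0 e4] x01 ann; split.
  exact/smooth_derive1n/smooth_smooth_kernel.
have bnd i : 2 * e <= shrink e (x i) <= 1 - e.
  by apply: shrink_bounds => //; rewrite ltW.
apply: (@subset_trans _ `[e, 1 - e]%classic); last first.
  by apply: subset_itvSoo; rewrite bnd_simp; lra.
rewrite closureE; apply: smallest_sub; first exact: interval_closed.
move=> s /= /eqP; apply: contra_notP => /negP.
rewrite in_itv/= negb_and -!ltNge => /orP[se|se]; rewrite smooth_kernelE//.
  (* at the node [x i] this polynomial is [(shrink e (x i) - s) ^ r] *)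
  pose p : {poly R} := ((2 * e - s)%:P + (1 - 3 * e) *: 'X) ^+ r.
  rewrite -[RHS](ann p); last first.
    apply: leq_trans (size_exp_leq _ _) _.
    rewrite ltnS -[leqRHS]mul1n leq_mul2r.
    apply/orP; right; rewrite -subn1 leq_subLR.
    rewrite (leq_trans (size_polyD _ _))// geq_max.
    rewrite (leq_trans (size_polyC_leq1 _))//.
    by rewrite (leq_trans (size_scale_leq _ _))// size_polyX.
  apply: eq_bigr => i _; congr (_ * _); rewrite step_ge1; last first.
    by rewrite ler_pdivlMr//; have /andP[] := bnd i; lra.
  by rewrite mulr1 horner_exp hornerD hornerC hornerZ hornerX /shrink addrAC.
rewrite big1// => i _; rewrite step_le0 ?mulr0//.
by rewrite ler_pdivrMr// mul0r; have /andP[] := bnd i; lra.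
Qed.

Lemma derive1n_smooth_kernel r N (c x : 'I_N -> R) e s : 0 < e ->
  derive1n r.+1 (smooth_kernel r c x e) s = (-1) ^+ r.+1 * \sum_(i < N)
    c i * (e^-1 *
      derive1n r.+1 (smooth_power r) (- e^-1 * s + shrink e (x i) / e)).
Proof.
move=> e0; rewrite derive1n_sum; last by move=> i; exact: smooth_kernel_term'.
rewrite mulr_sumr; apply: eq_bigr => i _.
set y := shrink e (x i) / e; pose g s := smooth_power r (- e^-1 * s + y).
have sg : smooth g by apply: smooth_affine; exact: smooth_smooth_power.
transitivity (c i * derive1n r.+1 (cst (e ^+ r) \* g) s).
  exact: (congr1 (@^~ s) (derive1nZ (c i) r.+1 (@smooth_kernel_term r e y))).
transitivity (c i * (e ^+ r * derive1n r.+1 g s)).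
  by congr (_ * _); exact: (congr1 (@^~ s) (derive1nZ (e ^+ r) r.+1 sg)).
rewrite (derive1n_affine _ _ _ _ (@smooth_smooth_power r)).
rewrite [RHS]mulrCA; congr (_ * _).
rewrite [LHS]mulrA [RHS]mulrA; congr (_ * _).
rewrite -(mulN1r e^-1) exprMn [LHS]mulrCA; congr (_ * _).
by rewrite exprS mulrCA -exprMn mulfV ?gt_eqF// expr1n mulr1.
Qed.

End spline_kernels.

Section kernel_limits.
Context {R : realType}.
Implicit Types (a s e x : R) (r m : nat).
Local Notation mu := (@lebesgue_measure R).

Lemma Rintegral_restrict (f : R -> R) (A D : set R) : A `<=` D ->
  (forall s, D s -> ~ A s -> f s = 0) ->
  \int[mu]_(s in D) f s = \int[mu]_(s in A) f s.
Proof.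
move=> AD f0; rewrite -[in RHS](setIidr AD) Rintegral_mkcondr.
apply: eq_Rintegral => s /set_mem Ds; rewrite patchE.
by case: ifPn => // /negP As; apply: f0 => // /mem_set.
Qed.

Lemma continuous_integrable_cc a b (f : R -> R) :
  {within `[a, b], continuous f} -> mu.-integrable `[a, b] (EFin \o f).
Proof.
move=> cf; apply: continuous_compact_integrable => //.
exact: segment_compact.
Qed.

Lemma Rintegral_FTC2 (f F : R -> R) a b : a <= b -> continuous f ->
  (forall s, is_derive s (1 : R) F (f s)) ->
  \int[mu]_(s in `[a, b]) f s = F b - F a.
Proof.
rewrite le_eqVlt => /predU1P[<- _ _|ab cf dF].
  by rewrite set_itv1 Rintegral_set1 subrr.
have cF : continuous F.
  by apply: derivable1_continuous => t; have [] := dF t.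
rewrite /Rintegral (@continuous_FTC2 _ f F)//.
- exact: continuous_subspaceT.
- split.
  + by move=> t _; have [] := dF t.
  + exact/cvg_at_right_filter/cF.
  + exact/cvg_at_left_filter/cF.
- by move=> t _; rewrite derive1E; have [] := dF t.
Qed.

(** Up to sign, the derivative of order [r.+1] of one term of [smooth_kernel]
    with coefficient [1]; it approximates [r`!] times the Dirac mass at [x]. *)
Definition dirac_kernel r e x s : R :=
  e^-1 * derive1n r.+1 (smooth_power r) (- e^-1 * s + shrink e x / e).

Lemma continuous_dirac_kernel r e x : continuous (dirac_kernel r e x).
Proof.
apply: smooth_continuous; apply: (@smoothM _ (cst e^-1)).
  exact: smooth_cst.
apply: smooth_affine.
exact/smooth_derive1n_smooth/smooth_smooth_power.
Qed.

Lemma integral_dirac_kernel r e x : 0 < e <= 4^-1 -> 0 <= x <= 1 ->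
  \int[mu]_(s in `[0, 1]) dirac_kernel r e x s = r`!%:R.
Proof.
move=> /andP[e0 e4] x01; pose g := derive1n r (@smooth_power R r).
have /andP[y0 y1] : 2 * e <= shrink e x <= 1 - e.
  by apply: shrink_bounds => //; rewrite ltW.
set y := shrink e x in y0 y1.
pose G (s : R) := (-1) * g (- e^-1 * s + y / e).
have dg t : derivable g t 1.
  exact/smooth_derive1n/smooth_smooth_power.
have dG s : is_derive s (1 : R) G (dirac_kernel r e x s).
  have [d1 d2] := @derive1_affine _ g (- e^-1) (y / e) s (dg _).
  apply: is_derive_eq (is_deriveZ (-1) (derivableP d1)) _.
  by rewrite -derive1E d2 -[LHS]/(-1 * _) mulN1r mulNr opprK.
rewrite (Rintegral_FTC2 ler01 (@continuous_dirac_kernel r e x) dG).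
rewrite /G /g derive1n_smooth_power_lt0; last first.
  by rewrite mulr1 -[- e^-1]mulN1r -mulrDl pmulr_llt0 ?invr_gt0//; lra.
rewrite derive1n_smooth_power_r; last first.
  by rewrite mulr0 add0r ltr_pdivlMr//; lra.
by rewrite mulr0 sub0r mulN1r opprK.
Qed.

Lemma dirac_kernel_approx r (M : R) (u : R -> R) e x (rho delta : R) :
  (forall y, `|derive1n r.+1 (smooth_power r) y| <= M) -> 0 <= delta ->
  {within `[0, 1], continuous u} -> 0 < e <= 4^-1 -> 0 <= x <= 1 ->
  3 * e <= rho ->
  (forall s, 0 <= s <= 1 -> `|s - x| <= rho -> `|u s - u x| <= delta) ->
  `|\int[mu]_(s in `[0, 1]) (u s * dirac_kernel r e x s) - r`!%:R * u x|
    <= delta * M.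
Proof.
move=> kM delta0 cu /[dup] e04 /andP[e0 e4] x01 erho urho.
have ck : {within `[0, 1], continuous (dirac_kernel r e x)}.
  exact: (continuous_subspaceT (@continuous_dirac_kernel r e x)).
have cuk : {within `[0, 1], continuous (fun s => u s * dirac_kernel r e x s)}.
  by move=> s; apply: cvgM; [exact: cu|exact: ck].
have cuxk : {within `[0, 1], continuous (fun s => u x * dirac_kernel r e x s)}.
  by move=> s; apply: cvgM; [exact: cvg_cst|exact: ck].
rewrite -(integral_dirac_kernel r e04 x01) mulrC -RintegralZl//; last first.
  exact: continuous_integrable_cc.
rewrite -RintegralB//; [|exact: continuous_integrable_cc..].
set f := (F in \int[_]_(s in _) F s).
have /andP[y0 y1] : 2 * e <= shrink e x <= 1 - e.
  by apply: shrink_bounds => //; rewrite ltW.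
have := @shrink_dist _ e x (ltW e0) x01.
set y := shrink e x in y0 y1 *; rewrite ler_norml => /andP[yx1 yx2].
have subI : `[y - e, y] `<=` (`[0, 1] : set R).
  by move=> s /=; rewrite !in_itv/= => /andP[? ?]; apply/andP; split; lra.
(* the kernel is supported in an interval of length [e] close to [x] *)
rewrite (@Rintegral_restrict f `[y - e, y])//; last first.
  move=> s _ /=; rewrite in_itv/= => /negP; rewrite negb_and -!ltNge => yes.
  rewrite /f /dirac_kernel derive1n_smooth_power_rS ?mulr0 ?subrr//.
  rewrite -/y (_ : - e^-1 * s + y / e = (y - s) / e); last by ring.
  case/orP: yes => ys.
    by right; rewrite ltr_pdivlMr//; lra.
  by left; rewrite pmulr_llt0 ?invr_gt0//; lra.
have intf : mu.-integrable `[y - e, y] (EFin \o f).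
  apply: (@integrableS _ _ _ mu `[0, 1]) => //.
  apply: continuous_integrable_cc => s; apply: cvgB; [exact: cuk|exact: cuxk].
apply: le_trans (le_normr_Rintegral _ intf) _ => //.
apply: (@le_trans _ _ (\int[mu]_(s in `[y - e, y]) (delta * (e^-1 * M)))).
  apply: le_Rintegral => //.
  - by have := integrable_norm intf; exact.
  - apply: continuous_integrable_cc; apply: continuous_subspaceT.
    exact: cst_continuous.
  - move=> s /[dup] /subI/=; rewrite !in_itv/= => s01 /andP[s1 s2].
    rewrite /f -mulrBl normrM ler_pM//.
      apply: urho => //; rewrite ler_norml; apply/andP; split; lra.
    rewrite normrM (gtr0_norm (_ : 0 < e^-1)) ?invr_gt0//.
    by rewrite ler_wpM2l// ltW// invr_gt0.
rewrite Rintegral_cst//= lebesgue_measure_itv/= lte_fin ltrBlDr ltrDl e0/=.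
rewrite opprB addrCA subrr addr0 -!mulrA [e^-1 * _]mulrCA.
by rewrite mulVf ?gt_eqF// mulr1.
Qed.

(** A sequence of scales at most [e] that tends to [0]. *)
Definition eps_seq e n : R := e / n.+1%:R.

Lemma eps_seq_gt0 e n : 0 < e -> 0 < eps_seq e n.
Proof. by move=> e0; rewrite divr_gt0. Qed.

Lemma eps_seq_le e n : 0 < e -> eps_seq e n <= e.
Proof. by move=> e0; rewrite ler_pdivrMr// ler_peMr ?ler1n// ltW. Qed.

Lemma cvg_eps_seq e : eps_seq e n @[n --> \oo] --> (0 : R).
Proof.
rewrite -[X in _ --> X](mulr0 e); apply: cvgM; first exact: cvg_cst.
exact: cvg_harmonic.
Qed.

Lemma cvg_dirac_kernel r (u : R -> R) e x : 0 < e <= 4^-1 -> 0 <= x <= 1 ->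
  {within `[0, 1], continuous u} ->
  \int[mu]_(s in `[0, 1]) (u s * dirac_kernel r (eps_seq e n) x s)
    @[n --> \oo] --> r`!%:R * u x.
Proof.
move=> /andP[e0 e4] x01 cu; apply/cvgrPdist_le => d d0.
have [M M0 kM] := derive1n_smooth_power_bounded (R := R) r.
have dM0 : 0 < d / (M + 1) by rewrite divr_gt0// ltr_wpDl.
have : (u @ within `[0, 1]%classic (nbhs x)) --> u x.
  by apply/(subspace_continuousP _ _).1 => //=; rewrite in_itv/=.
move=> /cvgrPdist_le /(_ _ dM0); rewrite near_withinE.
move=> /nbhs_ballP[rho /= rho0 urho].
have : \forall n \near \oo, `|0 - eps_seq e n| <= rho / 4.
  have /cvgrPdist_le := @cvg_eps_seq e; apply.
  by rewrite divr_gt0.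
apply: filterS => n; rewrite sub0r normrN (gtr0_norm (eps_seq_gt0 n e0)) => en.
rewrite distrC; apply: le_trans (@dirac_kernel_approx r M u (eps_seq e n) x
  (3 * (rho / 4)) (d / (M + 1)) kM (ltW dM0) cu _ x01 _ _) _.
- by rewrite eps_seq_gt0//= (le_trans (eps_seq_le _ _)).
- by rewrite ler_pM2l.
- move=> s s01 sx; rewrite distrC; apply: urho => /=; last by rewrite in_itv.
  by rewrite -ball_normE/= distrC (le_lt_trans sx)//; lra.
- by rewrite mulrAC ler_pdivrMr ?ltr_wpDl// ler_wpM2l ?lerDl// ltW.
Qed.

Lemma cvg_sumr N (f : 'I_N -> nat -> R) (l : 'I_N -> R) :
  (forall i, f i n @[n --> \oo] --> l i) ->
  \sum_(i < N) f i n @[n --> \oo] --> \sum_(i < N) l i.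
Proof.
by move=> fl; apply: cvg_big => //; exact: add_continuous.
Qed.

(** The limit of [smooth_kernel r c x e] as [e] tends to [0], almost
    everywhere on [[0, 1]]. *)
Definition spline_kernel r N (c x : 'I_N -> R) s : R :=
  \sum_(i < N) c i * cutoff (x i) (((x i)%:P - 'X) ^+ r) s.

Lemma cvg_shrink e x : shrink (eps_seq e n) x @[n --> \oo] --> x.
Proof.
rewrite [X in _ --> X](_ : x = 2 * 0 + (1 - 3 * 0) * x); last by ring.
apply: cvgD; first by apply: cvgM; [exact: cvg_cst|exact: cvg_eps_seq].
apply: cvgM; last exact: cvg_cst.
apply: cvgB; first exact: cvg_cst.
by apply: cvgM; [exact: cvg_cst|exact: cvg_eps_seq].
Qed.

Lemma cvg_smooth_kernel r N (c x : 'I_N -> R) e s : 0 < e -> 0 <= s ->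
  (forall i, s != x i) ->
  smooth_kernel r c x (eps_seq e n) s @[n --> \oo] --> spline_kernel r c x s.
Proof.
move=> e0 s0 sx; under eq_fun do rewrite smooth_kernelE ?eps_seq_gt0//.
apply: cvg_sumr => i.
apply: cvgM; first exact: cvg_cst.
rewrite /cutoff s0 /= horner_exp !hornerE.
have := sx i; rewrite neq_lt => /orP[six|xis].
  rewrite (ltW six) -[X in _ --> X]mulr1; apply: cvgM.
    apply: (@cvg_comp _ _ _ (fun n => shrink (eps_seq e n) (x i) - s)
      (fun y : R => y ^+ r) _ (nbhs (x i - s))).
      by apply: cvgB; [exact: cvg_shrink|exact: cvg_cst].
    exact: exprn_continuous.
  apply: cvg_near_cst; near=> n.
  rewrite step_ge1// ler_pdivlMr ?eps_seq_gt0// mul1r.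
  have : eps_seq e n <= (x i - s) / 2.
    near: n; apply: (cvgr_le 0); first exact: cvg_eps_seq.
    by rewrite divr_gt0// subr_gt0.
  have : (x i + s) / 2 <= shrink (eps_seq e n) (x i).
    near: n; apply: (cvgr_ge (x i)); first exact: cvg_shrink.
    by lra.
  lra.
rewrite leNgt xis /=; apply: cvg_near_cst; near=> n.
rewrite step_le0 ?mulr0// pmulr_lle0 ?invr_gt0 ?eps_seq_gt0// subr_le0.
near: n; apply: (cvgr_le (x i)); [exact: cvg_shrink|by []].
Unshelve. all: by end_near. Qed.

End kernel_limits.

(** * Divided differences as integrals of weak derivatives *)

Section weak_derivative_theory.
Context {R : realType}.
Implicit Types (a b s e : R) (u v w : R -> R) (r m : nat).
Local Notation mu := (@lebesgue_measure R).

Lemma cutoff_restrict a (p : {poly R}) : cutoff a p = horner p \_ `[0, a].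
Proof.
apply/funext => s; rewrite /cutoff patchE; congr (if _ then _ else _).
apply/idP/idP => [s0|/set_mem/=]; rewrite ?in_itv//.
by apply/mem_set; rewrite /= in_itv.
Qed.

Lemma measurable_cutoff a (p : {poly R}) : measurable_fun setT (cutoff a p).
Proof.
rewrite cutoff_restrict; apply/(measurable_restrictT _ _).1 => //.
apply: measurable_funTS; apply: continuous_measurable_fun.
exact: continuous_horner.
Qed.

Lemma measurable_spline_kernel r N (c x : 'I_N -> R) :
  measurable_fun setT (spline_kernel r c x).
Proof.
apply: measurable_sum => i; apply: measurable_funM => //.
exact: measurable_cutoff.
Qed.

Lemma ae_neq_points N (x : 'I_N -> R) :
  {ae mu, forall s, forall i, s != x i}.
Proof.
exists (range x); split.
- apply: countable_measurable => //.
  exact/finite_set_countable/finite_image.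
- apply: countable_lebesgue_measure0.
  exact/finite_set_countable/finite_image.
- move=> s /= /existsNP[i /negP]; rewrite negbK => /eqP ->.
  by exists i.
Qed.

Lemma cvg_integral_smooth_kernel r N (c x : 'I_N -> R) e v (D : set R) :
  measurable D -> D `<=` `[0, 1] -> mu.-integrable D (EFin \o v) ->
  0 < e <= 4^-1 -> (forall i, 0 <= x i <= 1) ->
  \int[mu]_(s in D) (v s * smooth_kernel r c x (eps_seq e n) s) @[n --> \oo]
    --> \int[mu]_(s in D) (v s * spline_kernel r c x s).
Proof.
move=> mD D01 iv /andP[e0 e4] x01.
have mv : measurable_fun D v.
  by apply/measurable_EFinP; exact: measurable_int iv.
pose C := \sum_(i < N) `|c i|.
have C0 : 0 <= C by exact: sumr_ge0.
have eps4 n : 0 < eps_seq e n <= 4^-1.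
  by rewrite eps_seq_gt0//= (le_trans (eps_seq_le _ _)).
have mk n : measurable_fun D
    (fun s => v s * smooth_kernel r c x (eps_seq e n) s).
  apply: measurable_funM => //; apply: measurable_funTS.
  apply: continuous_measurable_fun; apply: smooth_continuous.
  exact: smooth_smooth_kernel.
have ig : mu.-integrable D (fun s => (C%:E * `|(v s)%:E|)%E).
  apply: integrableZl => //; exact: integrable_abse.
have mlim : measurable_fun D
    (fun s => (v s * spline_kernel r c x s)%:E).
  apply/measurable_EFinP; apply: measurable_funM => //; apply: measurable_funTS.
  exact: measurable_spline_kernel.
have cvk : {ae mu, forall s, D s ->
    (v s * smooth_kernel r c x (eps_seq e n) s)%:E @[n --> \oo] -->
    (v s * spline_kernel r c x s)%:E}.
  have := ae_neq_points x; apply: filterS.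
    exact: (ae_filter_ringOfSetsType mu).
  move=> s sx Ds.
  apply/cvg_EFin; first exact: nearW.
  apply: cvgM; first exact: cvg_cst.
  apply: cvg_smooth_kernel => //.
  by have := D01 _ Ds; rewrite /= in_itv/= => /andP[].
have dom : {ae mu, forall s n, D s ->
    (`|(v s * smooth_kernel r c x (eps_seq e n) s)%:E| <=
     C%:E * `|(v s)%:E|)%E}.
  apply: aeW => s n Ds; rewrite /= -EFinM lee_fin normrM mulrC.
  rewrite ler_wpM2r// normr_smooth_kernel//.
  by have := D01 _ Ds; rewrite /= in_itv.
have mke n : measurable_fun D
    (fun s => (v s * smooth_kernel r c x (eps_seq e n) s)%:E).
  exact/measurable_EFinP.
have [ilim _ cv] := @dominated_convergence _ _ _
  (mu : {measure set _ -> \bar R}) D mD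
  (fun n s => (v s * smooth_kernel r c x (eps_seq e n) s)%:E) _ _
  mke mlim cvk ig dom.
rewrite /Rintegral; apply: fine_cvg; rewrite fineK//.
exact: integrable_fin_num ilim.
Qed.

Lemma Rintegral_oo_cc (f : R -> R) : mu.-integrable `[0, 1] (EFin \o f) ->
  \int[mu]_(s in `]0, 1[) f s = \int[mu]_(s in `[0, 1]) f s.
Proof.
move=> intf; rewrite Rintegral_itv_bndo_bndc; last first.
  by apply: integrableS intf => //; exact: subset_itv_oo_cc.
rewrite Rintegral_itv_obnd_cbnd//.
by apply: integrableS intf => //; exact: subset_itv_oc_cc.
Qed.

Lemma Rintegral_sum (D : set R) N (f : 'I_N -> R -> R) : measurable D ->
  (forall i, mu.-integrable D (EFin \o f i)) ->
  \int[mu]_(s in D) \sum_(i < N) f i s = \sum_(i < N) \int[mu]_(s in D) f i s.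
Proof.
move=> mD intf.
have ints (t : seq 'I_N) :
    mu.-integrable D (EFin \o (fun s => \sum_(i <- t) f i s)) /\
    \int[mu]_(s in D) \sum_(i <- t) f i s =
    \sum_(i <- t) \int[mu]_(s in D) f i s.
  elim: t => [|i t [IH1 IH2]].
    split.
      rewrite (_ : _ \o _ = cst 0%E); first exact: integrable0.
      by apply/funext => s /=; rewrite big_nil.
    rewrite big_nil; under eq_Rintegral do rewrite big_nil.
    by rewrite Rintegral_cst// mul0r.
  split.
    rewrite (_ : _ \o _ =
        ((EFin \o f i) \+ (EFin \o (fun s => (\sum_(i <- t) f i s)%R)))%E).
      exact: integrableD.
    by apply/funext => s /=; rewrite big_cons.
  rewrite big_cons -IH2 -RintegralD//.
  by apply: eq_Rintegral => s _; rewrite big_cons.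
exact: (ints _).2.
Qed.

(** Both sides of the defining identity of the weak derivative are passed to
    the limit, the test functions being the kernels [smooth_kernel]. *)
Lemma weak_derivative_kernel r N (c x : 'I_N -> R) u w :
  {within `[0, 1], continuous u} -> weak_derivative r.+1 u w ->
  mu.-integrable `]0, 1[ (EFin \o w) ->
  (forall i, 0 <= x i <= 1) -> annihilates r.+1 c x ->
  \int[mu]_(s in `]0, 1[) (w s * spline_kernel r c x s) =
  r`!%:R * \sum_(i < N) c i * u (x i).
Proof.
move=> cu [_ wu] iw x01 ann.
pose e : R := 4^-1.
have e4 : 0 < e <= 4^-1 by rewrite invr_gt0 ltr0n lexx.
have e0 : 0 < e by rewrite invr_gt0 ltr0n.
have eps4 n : 0 < eps_seq e n <= 4^-1.
  by rewrite eps_seq_gt0//= (le_trans (eps_seq_le _ _)).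
have cl := @cvg_integral_smooth_kernel r N c x e w `]0, 1[%classic
  (measurable_itv _) (@subset_itv_oo_cc _ _ _ _) iw e4 x01.
have cr : \sum_(i < N) c i * \int[mu]_(s in `[0, 1])
    (u s * dirac_kernel r (eps_seq e n) (x i) s) @[n --> \oo] -->
    \sum_(i < N) c i * (r`!%:R * u (x i)).
  apply: cvg_sumr => i; apply: cvgM; first exact: cvg_cst.
  exact: cvg_dirac_kernel.
rewrite mulr_sumr; under [RHS]eq_bigr do rewrite mulrCA.
apply: (@cvg_unique _ _ _ _ _ _ cl); first exact: Rhausdorff.
move: cr; apply: cvg_trans; apply: near_eq_cvg; apply: nearW => n.
move: (eps4 n); set eps := eps_seq e n => epsn.
have tk := test_function_smooth_kernel epsn x01 ann.
have := wu _ tk.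
have iu i : mu.-integrable `[0, 1]
    (EFin \o (fun s => u s * dirac_kernel r eps (x i) s)).
  apply: continuous_integrable_cc => s; apply: cvgM; first exact: cu.
  have := continuous_subspaceT (@continuous_dirac_kernel R r eps (x i)).
  exact.
have -> : \int[mu]_(s in `]0, 1[)
      (u s * derive1n r.+1 (smooth_kernel r c x eps) s)
    = (-1) ^+ r.+1 * \sum_(i < N) c i * \int[mu]_(s in `[0, 1])
    (u s * dirac_kernel r eps (x i) s).
  rewrite Rintegral_oo_cc; last first.
    have cd : {within `[0, 1], continuous
        (derive1n r.+1 (smooth_kernel r c x eps))}.
      apply: continuous_subspaceT; apply: smooth_continuous.
      by apply: smooth_derive1n_smooth; exact: smooth_smooth_kernel.
    by apply: continuous_integrable_cc => s; apply: cvgM; [exact: cu|exact: cd].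
  transitivity (\int[mu]_(s in `[0, 1]) \sum_(i < N)
      ((-1) ^+ r.+1 * c i) * (u s * dirac_kernel r eps (x i) s)).
    apply: eq_Rintegral => s _; rewrite derive1n_smooth_kernel; last first.
      by have /andP[] := epsn.
    rewrite mulrCA !mulr_sumr; apply: eq_bigr => i _.
    by rewrite -mulrA; congr (_ * _); rewrite mulrCA.
  rewrite Rintegral_sum//; last by move=> i; exact: (integrableZl _ _ (iu i)).
  rewrite mulr_sumr; apply: eq_bigr => i _.
  by rewrite RintegralZl// mulrA.
move=> h; apply: (mulfI (_ : (-1) ^+ r.+1 != 0 :> R)) => //.
by rewrite signr_eq0.
Qed.

End weak_derivative_theory.

(** * Uniqueness of weak derivatives *)

Section fundamental_lemma.
Context {R : realType}.
Implicit Types (a b s e : R) (g h u v w : R -> R) (j r m : nat).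
Local Notation mu := (@lebesgue_measure R).

Lemma locally_integrable_itv v a b : locally_integrable `]0, 1[ v ->
  0 < a -> b < 1 -> mu.-integrable `[a, b] (EFin \o v).
Proof.
move=> [mv _ iv] a0 b1.
have ab01 : `[a, b] `<=` (`]0, 1[ : set R).
  by apply: subset_itvSoo; rewrite bnd_simp.
apply/integrableP; split; last by apply: iv => //; exact: segment_compact.
by apply/measurable_EFinP; apply: measurable_funS mv.
Qed.

Section orthogonal_to_test_functions.
Variable v : R -> R.
Hypothesis locv : locally_integrable `]0, 1[ v.
Hypothesis v0 : forall phi, test_function phi ->
  \int[mu]_(t in `]0, 1[) (v t * phi t) = 0.

Let jump (i : 'I_2) : R := if i == 0 then 1 else -1.

(* The kernels of the nodes [b] and [a] with weights [1] and [-1] approximate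
   the indicator function of the interval from [a] to [b]. *)
Let Rintegral_itv_eq0 a b : 0 < a -> a < b -> b < 1 ->
  \int[mu]_(t in `]a, b]) v t = 0.
Proof.
move=> a0 ab b1.
pose x (i : 'I_2) : R := if i == 0 then b else a.
have sum2 (f : 'I_2 -> R) : \sum_(i < 2) jump i * f i = f 0 - f 1.
  rewrite !big_ord_recl big_ord0 /jump/= addr0 mul1r mulN1r.
  by congr (_ - f _); exact: val_inj.
have x01 i : 0 <= x i <= 1.
  by rewrite /x; case: ifP => _; apply/andP; split; lra.
have ann : annihilates 1 jump x.
  by move=> p /size1_polyC ->; rewrite sum2 !hornerC subrr.
(* a scale at which all kernels are supported in the compact set [D] *)
pose e := Num.min 4^-1 (Num.min (a / 4) ((1 - b) / 4)).
have e0 : 0 < e by rewrite !lt_min invr_gt0 ltr0n !divr_gt0// subr_gt0.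
have e4 : 0 < e <= 4^-1 by rewrite e0 ge_min lexx.
have ea : e <= a / 4 by rewrite !ge_min lexx !orbT.
have eb : e <= (1 - b) / 4 by rewrite !ge_min lexx !orbT.
pose D : set R := [set` `[a / 4, 1 - (1 - b) / 4]].
have D01 : D `<=` `[0, 1].
  by apply: subset_itvScc; rewrite bnd_simp; lra.
have D01' : D `<=` `]0, 1[.
  by apply: subset_itvSoo; rewrite bnd_simp; lra.
have iv : mu.-integrable D (EFin \o v).
  by apply: locally_integrable_itv => //; lra.
have := @cvg_integral_smooth_kernel R 0 2 jump x e v D (measurable_itv _)
  D01 iv e4 x01.
have -> : (fun n => \int[mu]_(s in D)
    (v s * smooth_kernel 0 jump x (eps_seq e n) s)) = cst 0.
  apply/funext => n /=; set eps := eps_seq e n.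
  have eps0 : 0 < eps by exact: eps_seq_gt0.
  have epse : eps <= e by exact: eps_seq_le.
  have eps4 : 0 < eps <= 4^-1.
    by rewrite eps0/= (le_trans epse)//; case/andP: e4.
  rewrite -(v0 (test_function_smooth_kernel eps4 x01 ann)).
  rewrite (Rintegral_restrict D01')// => s _ /= Ds.
  rewrite smooth_kernelE// sum2 !expr0 !mul1r.
  have := @shrink_dist _ eps b (ltW eps0) (x01 0).
  have := @shrink_dist _ eps a (ltW eps0) (x01 1).
  rewrite /x /= !ler_norml => /andP[ya1 ya2] /andP[yb1 yb2].
  move/negP: Ds; rewrite in_itv/= negb_and -!ltNge => /orP[sD|sD].
    by rewrite !step_ge1 ?subrr ?mulr0// ler_pdivlMr//; lra.
  by rewrite !step_le0 ?subrr ?mulr0// ler_pdivrMr//; lra.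
move=> /(cvg_unique (@Rhausdorff R)) /(_ (cvg_cst _)) H.
transitivity (\int[mu]_(s in D) (v s * spline_kernel 0 jump x s)); last first.
  by rewrite H.
have abD : `]a, b] `<=` D.
  by apply: subset_itvScc; rewrite bnd_simp; lra.
rewrite [RHS](Rintegral_restrict abD) => [|s Ds /= sab].
  apply: eq_Rintegral => s /set_mem/=; rewrite in_itv/= => /andP[as_ sb].
  rewrite /spline_kernel sum2 /cutoff /x /= sb (leNgt s a) as_ /= andbF andbT.
  by rewrite (ltW (lt_trans a0 as_)) expr0 hornerC subr0 mulr1.
rewrite /spline_kernel sum2 /cutoff /x /= !expr0 !hornerC.
have /andP[s0 s1] : 0 <= s <= 1 by have := D01 _ Ds; rewrite /= in_itv.
rewrite s0 /=; move: sab; rewrite in_itv/= => /negP.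
rewrite negb_and -leNgt -ltNge.
move=> /orP[sa|bs]; first by rewrite sa (le_trans sa (ltW ab)) subrr mulr0.
by rewrite (leNgt s b) bs (leNgt s a) (lt_trans ab bs) subrr mulr0.
Qed.

(* By Lebesgue differentiation, [v] is almost everywhere the derivative of its
   vanishing primitive. *)
Let ae_eq0_itv a b : 0 < a -> b < 1 ->
  {ae mu, forall t, a < t < b -> v t = 0}.
Proof.
move=> a0 b1.
have iv : mu.-integrable `[a, b] (EFin \o v) by exact: locally_integrable_itv.
have loc := integrable_locally_restrict (measurable_itv _) iv.
have ivT : mu.-integrable setT (EFin \o (v \_ `[a, b])).
  by move: iv => /integrable_mkcond; rewrite restrict_EFin; apply.
have ivy y : mu.-integrable [set` Interval (BRight a) (BRight y)]
    (EFin \o (v \_ `[a, b])) by apply: integrableS ivT.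
have := FTC1 ivy loc.
apply: filterS; first exact: (ae_filter_ringOfSetsType mu).
move=> t /= FTC /andP[at_ tb].
have /FTC[_] : (BRight a < BRight t)%O by rewrite bnd_simp.
rewrite patchE mem_set; last by rewrite /= in_itv/= !ltW.
move=> <-; apply: (@derive1n_eq0 _ _ 1 `]a, b[).
- exact: interval_open.
- by rewrite /= in_itv/= at_.
- move=> s; rewrite /= in_itv/= => /andP[as_ sb].
  rewrite -(Rintegral_itv_eq0 a0 as_ (lt_trans sb b1)).
  apply: eq_Rintegral => y /set_mem; rewrite /= in_itv/= => /andP[ay ys].
  by rewrite patchE mem_set// /= in_itv/= (ltW ay) (le_trans ys (ltW sb)).
Qed.

(** The fundamental lemma of the calculus of variations. *)
Lemma ae_eq0_test_function : {ae mu, forall t, 0 < t < 1 -> v t = 0}.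
Proof.
have /ae_foralln : forall n, {ae mu, forall t,
    n.+2%:R^-1 < t < 1 - n.+2%:R^-1 -> v t = 0}.
  by move=> n; apply: ae_eq0_itv; rewrite ?ltrBlDr ?ltrDl invr_gt0.
apply: filterS => t vt /andP[t0 t1].
have m0 : 0 < Num.min t (1 - t) by rewrite lt_min t0 subr_gt0.
pose n := Num.truncn (Num.min t (1 - t))^-1.
apply: (vt n).
have : n.+2%:R^-1 < Num.min t (1 - t).
  rewrite -[ltRHS]invrK ltf_pV2 ?posrE ?invr_gt0//.
  apply: lt_trans (_ : n.+1%:R < _); last by rewrite ltr_nat.
  by apply: truncnS_gt.
by rewrite lt_min => /andP[nt nt1]; rewrite nt ltrBrDr -ltrBrDl.
Qed.

End orthogonal_to_test_functions.

Lemma weak_derivative_unique j h g1 g2 :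
  weak_derivative j h g1 -> weak_derivative j h g2 ->
  {ae mu, forall t, 0 < t < 1 -> g1 t = g2 t}.
Proof.
move=> [i1 w1] [i2 w2].
have := @ae_eq0_test_function (g1 \- g2) (locally_integrableB i1 i2).
have H phi : test_function phi ->
    \int[mu]_(t in `]0, 1[) ((g1 \- g2) t * phi t) = 0.
  move=> tphi.
  have I1 := test_function_integrable 0 i1 tphi.
  have I2 := test_function_integrable 0 i2 tphi.
  under eq_Rintegral do rewrite mulrBl.
  rewrite RintegralB//; apply/eqP; rewrite subr_eq0; apply/eqP.
  apply: (mulfI (_ : (-1) ^+ j != 0)); first by rewrite signr_eq0.
  by rewrite -w1// -w2.
move=> /(_ H); apply: filterS; first exact: (ae_filter_ringOfSetsType mu).
by move=> t + t01 => /(_ t01) /= /eqP; rewrite subr_eq0 => /eqP.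
Qed.

Lemma weakDP j h g : weak_derivative j h g -> weak_derivative j h (weakD j h).
Proof.
by move=> wg; apply: (@xgetPex _ 0 [set g | weak_derivative j h g]); exists g.
Qed.

End fundamental_lemma.

(** * Truncated polynomials in Sobolev spaces *)

Section sobolev_theory.
Context {R : realType}.
Implicit Types (a b s : R) (f g h u v w : R -> R) (p : {poly R}) (j m : nat).
Local Notation mu := (@lebesgue_measure R).

Lemma Rintegral_oo_cc_measurable f : measurable_fun (`]0, 1[ : set R) f ->
  \int[mu]_(t in `[0, 1]) f t = \int[mu]_(t in `]0, 1[) f t.
Proof.
move=> mf; rewrite /Rintegral; congr fine.
rewrite [RHS]integral_itv_bndo_bndc; last exact/measurable_EFinP.
rewrite [RHS]integral_itv_obnd_cbnd//.
by apply/measurable_EFinP; exact: measurable_fun_itv_oc mf.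
Qed.

Lemma ae_eq_Rintegral_cc f g :
  measurable_fun (`]0, 1[ : set R) f -> measurable_fun (`]0, 1[ : set R) g ->
  {ae mu, forall t, 0 < t < 1 -> f t = g t} ->
  \int[mu]_(t in `[0, 1]) f t = \int[mu]_(t in `[0, 1]) g t.
Proof.
move=> mf mg fg; rewrite !Rintegral_oo_cc_measurable// /Rintegral; congr fine.
apply: ae_eq_integral => //; [exact/measurable_EFinP..|].
move: fg; apply: filterS; first exact: (ae_filter_ringOfSetsType mu).
by move=> t fg /=; rewrite in_itv/= => /fg ->.
Qed.

Lemma L2_unit_bounded f (M : R) : measurable_fun setT f ->
  (forall t, `|f t| <= M) -> L2_unit f.
Proof.
move=> mf fM; rewrite /L2_unit.
have mfI : measurable_fun setT (f \_ `[0, 1]).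
  by apply/(measurable_restrictT _ _).1 => //; exact: measurable_funTS.
apply/andP; split; first by rewrite inE.
rewrite inE /= /finite_norm unlock poweR_lty//.
rewrite [X in (X < _)%E](_ : _ =
    \int[mu]_t (((fun t : R => f t ^+ 2) \_ `[0, 1]) t)%:E)%E; last first.
  apply: eq_integral => t _; rewrite /= !patchE; case: ifPn => _.
    by rewrite powR_mulrn// real_normK// num_real.
  by rewrite normr0 powR0.
have : mu.-integrable `[0, 1] (EFin \o (fun t => f t ^+ 2)).
  apply: measurable_bounded_integrable => //=.
  - by rewrite lebesgue_measure_itv/= lte_fin ltr01 -EFinD ltry.
  - by apply: measurable_funTS; exact: measurable_funX.
  - exists (M ^+ 2); split; first exact: num_real.
    move=> y My t _ /=; apply: le_trans (ltW My).
    by rewrite normrX ler_pXn2r// ?nnegrE// (le_trans _ (fM t)).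
move=> /integrable_mkcond; rewrite restrict_EFin => /(_ (measurable_itv _)).
by move=> /integrable_lty; exact.
Qed.

Lemma L2_unit_mul f g : L2_unit f -> L2_unit g ->
  mu.-integrable `[0, 1] (EFin \o (fun t => f t * g t)).
Proof.
move=> lf lg; have := Lfun2_mul_Lfun1 lf lg.
have -> : (f \_ `[0, 1] : R -> R) \* (g \_ `[0, 1] : R -> R) =
    (fun t => f t * g t) \_ `[0, 1].
  by apply/funext => t /=; rewrite !patchE; case: ifP => // _; exact: mulr0.
move=> /Lfun1_integrable; rewrite -restrict_EFin => H.
by apply/integrable_mkcond; [exact: measurable_itv|exact: H].
Qed.

Lemma L2_unit_integrable f : L2_unit f -> mu.-integrable `[0, 1] (EFin \o f).
Proof.
move=> lf; have l1 : L2_unit (cst 1 : R -> R).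
  by apply: (@L2_unit_bounded _ 1) => // t; rewrite normr1.
have := L2_unit_mul lf l1; rewrite (_ : (fun t => _) = f)//.
by apply/funext => t; rewrite mulr1.
Qed.

Lemma cutoff_bounded a p : exists M, forall s, `|cutoff a p s| <= M.
Proof.
have cp : {within `[0, a], continuous (horner p)}.
  exact: (continuous_subspaceT (@continuous_horner R p)).
have [M [_ /(_ (`|M| + 1))]] :=
  compact_bounded (continuous_compact cp (@segment_compact _ 0 a)).
move=> /(_ (ltr_pwDr ltr01 (ler_norm _)))/= pM.
exists (`|M| + 1) => s; rewrite /cutoff; case: ifPn => sa.
  by apply: pM; exists s => //=; rewrite in_itv.
by rewrite normr0 addr_ge0.
Qed.

Lemma L2_unit_cutoff a p : L2_unit (cutoff a p).
Proof.
have [M pM] := cutoff_bounded a p.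
exact: L2_unit_bounded (measurable_cutoff a p) pM.
Qed.

Lemma L2_unit_locally_integrable f : L2_unit f -> locally_integrable `]0, 1[ f.
Proof.
move=> lf; apply: open_integrable_locally; first exact: interval_open.
apply: integrableS (L2_unit_integrable lf) => //.
exact: subset_itv_oo_cc.
Qed.

Lemma test_function_derive1n_eq0 (phi : R -> R) j t : test_function phi ->
  ~ (0 < t < 1) -> derive1n j phi t = 0.
Proof.
move=> /[dup] tphi [_ sphi] t01; apply: test_function_derive1n0 => //.
by move=> /sphi /=; rewrite in_itv.
Qed.

(** Integration by parts: the boundary term at [a] vanishes because [a] is a
    root of [p], or because [a = 1] is outside the support of [phi]. *)
Lemma integral_cutoff_derive1n a p (phi : R -> R) j : 0 <= a <= 1 ->
  a = 1 \/ p.[a] = 0 -> test_function phi ->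
  \int[mu]_(t in `]0, 1[) (cutoff a p t * derive1n j.+1 phi t) =
  - \int[mu]_(t in `]0, 1[) (cutoff a p^`() t * derive1n j phi t).
Proof.
move=> /andP[a0 a1] pa /[dup] tphi [dphi _].
pose psi := derive1n j phi.
have cphi i : continuous (derive1n i phi).
  by apply: derivable1_continuous => t; exact: dphi.
have mcut q i : measurable_fun (`]0, 1[ : set R)
    (fun t => cutoff a q t * derive1n i phi t).
  apply: measurable_funTS; apply: measurable_funM.
    exact: measurable_cutoff.
  exact: continuous_measurable_fun.
have E q i : \int[mu]_(t in `]0, 1[) (cutoff a q t * derive1n i phi t) =
    \int[mu]_(t in `[0, a]) (q.[t] * derive1n i phi t).
  rewrite -Rintegral_oo_cc_measurable// (@Rintegral_restrict _ _ `[0, a]).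
  - apply: eq_Rintegral => t /set_mem/=; rewrite in_itv/= => ta.
    by rewrite /cutoff ta.
  - by apply: subset_itvScc; rewrite bnd_simp.
  - move=> t _ /=; rewrite in_itv/= => /negP/negbTE ta.
    by rewrite /cutoff ta mul0r.
have I q i :
    mu.-integrable `[0, a] (EFin \o (fun t => q.[t] * derive1n i phi t)).
  apply: continuous_integrable_cc; apply: continuous_subspaceT => t.
  by apply: cvgM; [exact: continuous_horner|exact: cphi].
rewrite !E; apply/eqP; rewrite -addr_eq0 -RintegralD//; apply/eqP.
have dF t : is_derive t (1 : R) (fun t => p.[t] * psi t)
    (p.[t] * derive1n j.+1 phi t + p^`().[t] * psi t).
  have dpsi : is_derive t (1 : R) psi (derive1n j.+1 phi t).
    by rewrite derive1nS derive1E; exact/derivableP/dphi.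
  have := is_deriveM (is_derive_poly p t) dpsi.
  by move=> H; apply: is_derive_eq H _; rewrite [X in _ + X]mulrC.
rewrite (Rintegral_FTC2 a0 _ dF); last first.
  move=> t; apply: cvgD; apply: cvgM; do ?exact: continuous_horner; exact: cphi.
rewrite [psi 0](test_function_derive1n_eq0 _ tphi) ?ltxx// mulr0 subr0.
case: pa => [->|->]; last by rewrite mul0r.
by rewrite [psi 1](test_function_derive1n_eq0 _ tphi) ?mulr0// ltxx andbF.
Qed.

Lemma weak_derivative_cutoff a p j : 0 <= a <= 1 ->
  a = 1 \/ (forall i, (i < j)%N -> p^`(i).[a] = 0) ->
  weak_derivative j (cutoff a p) (cutoff a p^`(j)).
Proof.
move=> a01 pa; split.
  exact/L2_unit_locally_integrable/L2_unit_cutoff.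
move=> phi tphi; elim: j p pa => [|j IH] p pa.
  by rewrite derivn0 mul1r.
rewrite integral_cutoff_derive1n//; last first.
  case: pa => [|pa]; [by left|right].
  by have := pa 0%N isT; rewrite derivn0.
rewrite IH; last first.
  case: pa => [|pa]; [by left|right=> i ij].
  by rewrite -derivSn pa.
by rewrite -derivSn exprS mulN1r mulNr.
Qed.

Lemma cutoff_sobolev a p m : 0 <= a <= 1 ->
  a = 1 \/ (forall i, (i < m)%N -> p^`(i).[a] = 0) -> (0 < m)%N ->
  cutoff a p \in @sobolev_pred R m.
Proof.
move=> /[dup] a01 /andP[a0 a1] pa m0; apply/mem_set; split.
- apply/funext => t; rewrite patchE; case: ifPn => //.
  rewrite /cutoff; case: ifP => // /andP[t0 ta] /negP[]; apply/mem_set.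
  by rewrite /= in_itv/= t0 (le_trans ta).
(* on [[0, 1]] the truncation is [p (min t a)], since [a = 1] or [p a = 0] *)
- have cmin : {within `[0, 1], continuous (fun t => p.[Num.min t a])}.
    apply: continuous_subspaceT => t.
    apply: (@cvg_comp _ _ _ (fun t => Num.min t a) (horner p) _
      (nbhs (Num.min t a))).
      have := @continuous_min R R id (cst a) t; apply; first exact: cvg_id.
      exact: cvg_cst.
    exact: continuous_horner.
  have E (t : R) : 0 <= t -> t <= 1 -> p.[Num.min t a] = cutoff a p t.
    move=> t0 t1; rewrite /cutoff t0/=.
    case: leP => // ta; case: pa => [a1'|/(_ 0%N m0)]; last by rewrite derivn0.
    by move: ta; rewrite a1' ltNge t1.
  apply: subspace_eq_continuous cmin => t /set_mem/=.
  by rewrite in_itv/= => /andP[]; exact: E.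
- exact: L2_unit_cutoff.
- move=> j /andP[_ jm]; exists (cutoff a p^`(j)).
  apply: weak_derivative_cutoff => //.
  by case: pa => [|pa]; [left|right => i ij; apply: pa; exact: leq_trans jm].
- exists (cutoff a p^`(m)); first exact: weak_derivative_cutoff.
  exact: L2_unit_cutoff.
Qed.

End sobolev_theory.

(** * The roughness semi-inner product *)

Section seminorm.
Context {R : realType} {m : nat}.
Implicit Types (u v w : sobolev R m) (g h : R -> R) (c t : R).
Local Notation mu := (@lebesgue_measure R).

Lemma sobolev_linE c u v t : (c *: u + v) t = c * u t + v t.
Proof. by []. Qed.

Lemma sobolevD u v t : (u + v) t = u t + v t.
Proof. by []. Qed.

Lemma sobolevZ c u t : (c *: u) t = c * u t.
Proof. by []. Qed.

Lemma sobolev0 t : (0 : sobolev R m) t = 0.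
Proof. by []. Qed.

Lemma sobolev_sum (I : Type) (s : seq I) (f : I -> sobolev R m) t :
  (\sum_(i <- s) f i) t = \sum_(i <- s) f i t.
Proof.
by elim: s => [|i s IH]; rewrite ?big_nil ?big_cons ?sobolev0// sobolevD IH.
Qed.

Lemma sobolev_eq u v : (forall t, 0 <= t <= 1 -> u t = v t) -> u = v.
Proof.
move=> uv; apply: val_inj; apply/funext => t /=.
have [pu _ _ _ _] := set_mem (sobolev_funP u).
have [pv _ _ _ _] := set_mem (sobolev_funP v).
rewrite -pu -pv !patchE; case: ifPn => // /set_mem/=.
by rewrite in_itv/=; exact: uv.
Qed.

Lemma sobolev_continuous u : {within `[0, 1], continuous u}.
Proof. by have [] := set_mem (sobolev_funP u). Qed.

Lemma sobolev_locally_integrable u : locally_integrable `]0, 1[ u.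
Proof. exact/within_locally_integrable/sobolev_continuous. Qed.

Lemma sobolev_weak_derivative u :
  exists2 g, weak_derivative m u g & L2_unit g.
Proof. by have [] := set_mem (sobolev_funP u). Qed.

Lemma weakD_locally_integrable u : locally_integrable `]0, 1[ (weakD m u).
Proof. by have [g /weakDP[]] := sobolev_weak_derivative u. Qed.

Lemma weakD_measurable u : measurable_fun (`]0, 1[ : set R) (weakD m u).
Proof. by have [] := weakD_locally_integrable u. Qed.

Lemma weakD_ae u g : weak_derivative m u g ->
  {ae mu, forall t, 0 < t < 1 -> weakD m u t = g t}.
Proof. by move=> wg; exact: weak_derivative_unique (weakDP wg) wg. Qed.

(** The semi-inner product of [H^m] that measures roughness. *)
Definition semi u v : R := \int[mu]_(t in `[0, 1]) (weakD m u t * weakD m v t).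

(** Any weak derivatives of order [m] may be used to compute [semi]. *)
Lemma semiE u v g h : weak_derivative m u g -> weak_derivative m v h ->
  semi u v = \int[mu]_(t in `[0, 1]) (g t * h t).
Proof.
move=> wg wh; apply: ae_eq_Rintegral_cc.
- by apply: measurable_funM; exact: weakD_measurable.
- by apply: measurable_funM; [case: wg => -[]|case: wh => -[]].
- have := weakD_ae wg; apply: filterS2 (weakD_ae wh).
    exact: (ae_filter_ringOfSetsType mu).
  by move=> t /[swap] h1 h2 t01; rewrite h1// h2.
Qed.

Lemma semiC u v : semi u v = semi v u.
Proof. by apply: eq_Rintegral => t _; rewrite mulrC. Qed.

Lemma semi_sqr u : semi u u = \int[mu]_(t in `[0, 1]) (weakD m u t ^+ 2).
Proof. by apply: eq_Rintegral => t _; rewrite expr2. Qed.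

Lemma semi_ge0 u : 0 <= semi u u.
Proof. by rewrite semi_sqr; apply: Rintegral_ge0 => t _; exact: sqr_ge0. Qed.

Lemma semi_linl c u v w : semi (c *: u + v) w = c * semi u w + semi v w.
Proof.
have [gu wu lu] := sobolev_weak_derivative u.
have [gv wv lv] := sobolev_weak_derivative v.
have [gw ww lw] := sobolev_weak_derivative w.
have wuv := weak_derivative_lin c (sobolev_locally_integrable u)
  (sobolev_locally_integrable v) wu wv.
rewrite (semiE (wuv : weak_derivative m (c *: u + v) _) ww) (semiE wu ww).
rewrite (semiE wv ww) -RintegralZl//; last exact: L2_unit_mul.
rewrite -RintegralD//; last exact: L2_unit_mul.
  by apply: eq_Rintegral => t _; rewrite mulrA -mulrDl.
by have := integrableZl _ c (L2_unit_mul lu lw); exact.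
Qed.

Lemma semi0l w : semi 0 w = 0.
Proof.
have := semi_linl (-1) (0 : sobolev R m) 0 w.
by rewrite scaler0 addr0 mulN1r addNr.
Qed.

Lemma semiDl u v w : semi (u + v) w = semi u w + semi v w.
Proof. by rewrite -[u]scale1r semi_linl mul1r scale1r. Qed.

Lemma semiDr u v w : semi u (v + w) = semi u v + semi u w.
Proof. by rewrite semiC semiDl (semiC v) (semiC w). Qed.

Lemma semi_eq0 u : semi u u = 0 ->
  {ae mu, forall t, 0 < t < 1 -> weakD m u t = 0}.
Proof.
have [g wg lg] := sobolev_weak_derivative u.
rewrite (semiE wg wg) => s0.
have mg : measurable_fun (`]0, 1[ : set R) g by case: wg => -[].
have mgg : measurable_fun (`]0, 1[ : set R) (fun t => g t * g t).
  exact: measurable_funM.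
rewrite Rintegral_oo_cc_measurable// in s0.
have igg : mu.-integrable (`]0, 1[ : set R) (EFin \o (fun t => g t * g t)).
  by apply: integrableS (L2_unit_mul lg lg) => //; exact: subset_itv_oo_cc.
have : (\int[mu]_(t in `]0%R, 1%R[) `|(g t * g t)%:E| = 0)%E.
  under eq_integral do rewrite gee0_abs ?lee_fin -?expr2 ?sqr_ge0//.
  under eq_integral do rewrite expr2.
  by rewrite -[LHS]fineK; [congr EFin|exact: integrable_fin_num igg].
move=> /ae_eq_integral_abs H.
have := H (measurable_itv _) ((measurable_EFinP _ _).2 mgg).
apply: filterS2 (weakD_ae wg); first exact: (ae_filter_ringOfSetsType mu).
move=> t wgt gg0 t01; rewrite wgt//.
have := gg0; rewrite /= in_itv/= => /(_ t01) [] /eqP.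
by rewrite mulf_eq0 orbb => /eqP.
Qed.

End seminorm.

(** * Splines and polynomials *)

Section spline_space.
Context {R : realType} {r : nat}.
Local Notation m := r.+1.
Implicit Types (u v w : sobolev R m) (g h : R -> R) (a c t : R).
Local Notation mu := (@lebesgue_measure R).

Lemma semi_suml (I : Type) (s : seq I) (c : I -> R) (f : I -> sobolev R m) w :
  semi (\sum_(i <- s) c i *: f i) w = \sum_(i <- s) c i * semi (f i) w.
Proof.
elim: s => [|i s IH]; first by rewrite !big_nil semi0l.
by rewrite !big_cons semi_linl IH.
Qed.

(** Divided differences of order [m] are integrals of the [m]-th derivative. *)
Lemma divided_difference N (c x : 'I_N -> R) u g :
  weak_derivative m u g -> L2_unit g ->
  (forall i, 0 <= x i <= 1) -> annihilates m c x ->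
  \int[mu]_(s in `[0, 1]) (g s * spline_kernel r c x s) =
  r`!%:R * \sum_(i < N) c i * u (x i).
Proof.
move=> wg lg x01 ann.
rewrite -(weak_derivative_kernel (@sobolev_continuous _ _ u) wg)//; last first.
  by apply: integrableS (L2_unit_integrable lg) => //; exact: subset_itv_oo_cc.
apply: Rintegral_oo_cc_measurable; apply: measurable_funM.
  by case: wg => -[].
by apply: measurable_funTS; exact: measurable_spline_kernel.
Qed.

Lemma semi_eq0_annihilates N (c x : 'I_N -> R) u : semi u u = 0 ->
  (forall i, 0 <= x i <= 1) -> annihilates m c x ->
  \sum_(i < N) c i * u (x i) = 0.
Proof.
move=> u0 x01 ann; have [g wg lg] := sobolev_weak_derivative u.
apply: (mulfI (_ : r`!%:R != 0 :> R)).
  by rewrite pnatr_eq0 -lt0n fact_gt0.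
rewrite mulr0 -(divided_difference wg lg x01 ann).
have mg : measurable_fun (`]0, 1[ : set R) g by case: wg => -[].
rewrite (@ae_eq_Rintegral_cc _ _ (cst 0)).
- by rewrite Rintegral_cst// mul0r.
- apply: measurable_funM => //; apply: measurable_funTS.
  exact: measurable_spline_kernel.
- exact: measurable_cst.
- apply: filterS2 (weakD_ae wg) (semi_eq0 u0).
    exact: (ae_filter_ringOfSetsType mu).
  by move=> t h1 h2 t01; rewrite -h1// h2// mul0r.
Qed.

(** The kernel of the semi-norm consists of polynomials: [u] coincides with its
    Lagrange interpolation polynomial. *)
Lemma semi_eq0_polynomial u : semi u u = 0 -> is_polynomial u.
Proof.
move=> u0; pose x (i : nat) : R := i.+1%:R^-1.
have x_inj : injective x.
  by move=> i j /invr_inj /eqP; rewrite eqr_nat eqSS => /eqP.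
have x01 i : 0 <= x i <= 1.
  by rewrite invr_ge0 ler0n invf_le1 ?ltr0n// ler1n.
pose L (i : 'I_m) : {poly R} := tnth (lagrange m x) i.
exists (\sum_(i < m) u (x i) *: L i).
  apply: leq_trans (size_sum _ _ _) _; apply/bigmax_leqP => i _.
  by rewrite (leq_trans (size_scale_leq _ _))// size_lagrange_.
move=> t; rewrite in_itv/= => t01; rewrite horner_sum.
(* the nodes of the interpolation and the point [t], which comes first *)
pose y (i : 'I_m.+1) := if unlift ord0 i is Some j then x j else t.
pose c (i : 'I_m.+1) := if unlift ord0 i is Some j then - (L j).[t] else 1.
have sumE (f : R -> R) : \sum_(i < m.+1) c i * f (y i) =
    f t - \sum_(i < m) (L i).[t] * f (x i).
  rewrite big_ord_recl /c /y unlift_none mul1r -sumrN; congr (_ + _).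
  by apply: eq_bigr => i _; rewrite liftK mulNr.
have ann : annihilates m c y.
  move=> p sp; rewrite (sumE (horner p)) {1}(lagrange_gen _ x_inj sp)//.
  rewrite horner_sum; apply/eqP; rewrite subr_eq0; apply/eqP.
  apply: eq_bigr => i _.
  by rewrite hornerM hornerC mulrC.
have y01 i : 0 <= y i <= 1 by rewrite /y; case: unlift.
have := semi_eq0_annihilates u0 y01 ann.
rewrite sumE => /eqP; rewrite subr_eq0 => /eqP ->.
by apply: eq_bigr => i _; rewrite hornerZ mulrC.
Qed.

Lemma polynomial_eq0 n (x : 'I_n -> R) (p : {poly R}) : injective x ->
  (size p <= n)%N -> (forall i, p.[x i] = 0) -> p = 0.
Proof.
move=> xinj sp px; apply: (@roots_geq_poly_eq0 _ p [seq x i | i <- enum 'I_n]).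
- by apply/allP => _ /mapP[i _ ->]; apply/rootP.
- by rewrite map_inj_uniq// enum_uniq.
- by rewrite size_map size_enum_ord.
Qed.

Lemma semi_eq0_eq0 n (x : 'I_n -> R) u : injective x -> (m <= n)%N ->
  (forall i, 0 <= x i <= 1) ->
  semi u u = 0 -> (forall i, u (x i) = 0) -> u = 0.
Proof.
move=> xinj mn x01 /semi_eq0_polynomial[p sp up] ux.
have p0 : p = 0.
  apply: (polynomial_eq0 xinj (leq_trans sp mn)) => i.
  by rewrite -up ?ux// in_itv/=; exact: x01.
apply: sobolev_eq => t t01; rewrite up; last by rewrite in_itv.
by rewrite p0 horner0.
Qed.

Lemma derivn_exp_subX a N j : (((a%:P - 'X) ^+ N)^`(j) : {poly R}) =
  ((-1) ^+ j * (N ^_ j)%:R) *: (a%:P - 'X) ^+ (N - j).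
Proof.
elim: j => [|j IH].
  by rewrite derivn0 ffactn0 mulr1 scale1r subn0.
rewrite derivnS IH derivZ deriv_exp derivB derivC derivX sub0r mulN1r.
rewrite ffactnSr natrM -subnS -[- (_ ^+ _)]scaleN1r.
rewrite -[_ *+ (N - j)]scaler_nat !scalerA.
by congr (_ *: _); rewrite exprS; ring.
Qed.

(** A multiple of [(a - t) ^ (2 m - 1)], normalized so that its [m]-th
    derivative is [(a - t) ^ (m - 1)]. *)
Definition spline_poly a : {poly R} :=
  ((-1) ^+ m * r`!%:R / (r + r).+1`!%:R) *: (a%:P - 'X) ^+ (r + r).+1.

Lemma derivn_spline_poly a : (spline_poly a)^`(m) = (a%:P - 'X) ^+ r.
Proof.
rewrite /spline_poly derivnZ derivn_exp_subX scalerA.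
have -> : ((r + r).+1 - m = r)%N by rewrite subSS addnK.
rewrite -[RHS]scale1r; congr (_ *: _).
have rn0 : (r + r).+1`!%:R != 0 :> R by rewrite pnatr_eq0 -lt0n fact_gt0.
have : ((r + r).+1 ^_ m * r`! = (r + r).+1`!)%N.
  have := @ffact_fact (r + r).+1 m; rewrite subSS addnK ltnS leq_addr; exact.
move=> /(congr1 (fun k => k%:R : R)); rewrite natrM => E.
rewrite mulrCA !mulrA -exprMn mulrNN mulr1 expr1n mul1r.
by rewrite mulrAC [r`!%:R * _]mulrC E mulfV.
Qed.

Lemma spline_poly_vanish a i : (i < m)%N -> (spline_poly a)^`(i).[a] = 0.
Proof.
move=> im; rewrite /spline_poly derivnZ derivn_exp_subX !hornerZ horner_exp.
rewrite hornerD hornerN hornerC hornerX subrr expr0n subn_eq0.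
by rewrite leqNgt ltnS (leq_trans (_ : i <= r)%N) ?leq_addr//= !mulr0.
Qed.

(** A multiple of the function [(a - t)_+ ^ (2 m - 1)] on [[0, 1]]; its [m]-th
    weak derivative is [(a - t)_+ ^ (m - 1)]. *)
Definition spline_elt a (a01 : 0 <= a <= 1) : sobolev R m :=
  Sobolev (cutoff_sobolev a01 (or_intror (@spline_poly_vanish a)) (ltn0Sn r)).

Lemma weak_derivative_spline_elt a (a01 : 0 <= a <= 1) :
  weak_derivative m (spline_elt a01) (cutoff a ((a%:P - 'X) ^+ r)).
Proof.
rewrite -derivn_spline_poly; apply: weak_derivative_cutoff => //; right.
exact: spline_poly_vanish.
Qed.

Lemma itv01_1 : 0 <= (1 : R) <= 1. Proof. by rewrite ler01 lexx. Qed.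

(** The restriction of a polynomial to [[0, 1]]. *)
Definition poly_elt (p : {poly R}) : sobolev R m :=
  Sobolev (cutoff_sobolev (p := p) itv01_1 (or_introl erefl) (ltn0Sn r)).

Lemma poly_eltE p t : 0 <= t <= 1 -> poly_elt p t = p.[t].
Proof. by rewrite /= /cutoff => ->. Qed.

Lemma semi_poly_elt (p : {poly R}) w :
  (size p <= m)%N -> semi (poly_elt p) w = 0.
Proof.
move=> sp; have wp : weak_derivative m (poly_elt p) (cutoff 1 p^`(m)).
  by apply: weak_derivative_cutoff; [exact: itv01_1|left].
have [g wg lg] := sobolev_weak_derivative w.
rewrite (semiE wp wg); have -> : p^`(m) = 0 by exact: derivn_poly0.
transitivity (\int[mu]_(t in (`[0, 1] : set R)) (cst 0 t : R)).
  by apply: eq_Rintegral => t _; rewrite /cutoff horner0 if_same mul0r.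
by rewrite Rintegral_cst// mul0r.
Qed.

(** Splines represent the divided differences for the semi-inner product. *)
Lemma semi_spline n (x c : 'I_n -> R) (x01 : forall i, 0 <= x i <= 1) w :
  annihilates m c x ->
  semi (\sum_(i < n) c i *: spline_elt (x01 i)) w =
  r`!%:R * \sum_(i < n) c i * w (x i).
Proof.
move=> ann; have [g wg lg] := sobolev_weak_derivative w.
rewrite semi_suml -(divided_difference wg lg x01 ann).
transitivity (\int[mu]_(s in `[0, 1]) \sum_(i < n)
    c i * (cutoff (x i) (((x i)%:P - 'X) ^+ r) s * g s)); last first.
  apply: eq_Rintegral => s _; rewrite mulrC mulr_suml.
  by apply: eq_bigr => i _; rewrite mulrA.
have I i : mu.-integrable `[0, 1]
    (EFin \o (fun s => cutoff (x i) (((x i)%:P - 'X) ^+ r) s * g s)).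
  by apply: L2_unit_mul => //; exact: L2_unit_cutoff.
rewrite Rintegral_sum//; last first.
  by move=> i; have := integrableZl _ (c i) (I i); exact.
apply: eq_bigr => i _; rewrite RintegralZl//.
by rewrite (semiE (weak_derivative_spline_elt (x01 i)) wg).
Qed.

End spline_space.

(** * The smoothing spline as a linear function of the sample *)

Lemma injective_rowmap_inverse (R : fieldType) (k : nat)
    (f : 'rV[R]_k -> 'rV[R]_k) : linear f ->
  (forall v, f v = 0 -> v = 0) -> exists M : 'M[R]_k, forall y, f (y *m M) = y.
Proof.
move=> lf finj.
pose lM := GRing.isLinear.Build R 'rV[R]_k 'rV[R]_k *:%R f lf.
pose F : {linear 'rV[R]_k -> 'rV[R]_k} := HB.pack f lM.
exists (invmx (lin1_mx F)) => y.
have FE v : v *m lin1_mx F = f v by rewrite mul_rV_lin1.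
rewrite -FE mulmxKV// -row_free_unit; apply/inj_row_free => v.
by rewrite FE; exact: finj.
Qed.

Section smoothing_spline_existence.
Context {R : realType} {r n : nat}.
Local Notation m := r.+1.
Variables (tau : n.-tuple R) (lambda : R).
Hypotheses (tau01 : forall i, 0 <= tnth tau i <= 1).
Hypotheses (tau_inj : injective (tnth tau)) (mn : (m <= n)%N).
Hypothesis lambda_gt0 : 0 < lambda.
Implicit Types (u h g : sobolev R m) (y : 'rV[R]_n).

(* A vector of coefficients: those of the truncated powers, then those of a
   polynomial of degree less than [m]. *)
Let kn (v : 'rV[R]_(n + m)) (l : 'I_n) : R := lsubmx v 0 l.

Let spline (v : 'rV[R]_(n + m)) : sobolev R m :=
  \sum_(l < n) kn v l *: spline_elt (tau01 l) + poly_elt (rVpoly (rsubmx v)).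

Let poly_elt_lin a (p q : {poly R}) :
  poly_elt (a *: p + q) = a *: poly_elt p + poly_elt q :> sobolev R m.
Proof.
apply: sobolev_eq => t t01.
by rewrite sobolev_linE !poly_eltE// hornerD hornerZ.
Qed.

Let kn_lin a v w l : kn (a *: v + w) l = a * kn v l + kn w l.
Proof. by rewrite /kn linearP !mxE. Qed.

Let spline_lin a v w : spline (a *: v + w) = a *: spline v + spline w.
Proof.
rewrite /spline linearP linearP poly_elt_lin scalerDr scaler_sumr addrACA.
congr (_ + _); rewrite -big_split; apply: eq_bigr => l _ /=.
by rewrite kn_lin scalerDl scalerA.
Qed.

Let weight : R := lambda * r`!%:R * n%:R.

Let n_gt0 : (0 < n)%N. Proof. exact: leq_trans mn. Qed.

Let weight_gt0 : 0 < weight.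
Proof. by rewrite !mulr_gt0// ltr0n// fact_gt0. Qed.

(* The normal equation at the nodes, and the conditions that the coefficients
   of the truncated powers annihilate the polynomials. *)
Let system (v : 'rV[R]_(n + m)) : 'rV[R]_(n + m) :=
  row_mx (\row_l (weight * kn v l + spline v (tnth tau l)))
    (\row_(j < m) \sum_(l < n) kn v l * tnth tau l ^+ j).

Let system_lin : linear system.
Proof.
move=> a v w; rewrite /system scale_row_mx add_row_mx; congr row_mx.
  apply/rowP => l; rewrite !mxE spline_lin sobolev_linE kn_lin; ring.
apply/rowP => j; rewrite !mxE mulr_sumr -big_split; apply: eq_bigr => l _ /=.
by rewrite kn_lin mulrDl mulrA.
Qed.

Let moments_annihilate (c : 'I_n -> R) :
  (forall j : 'I_m, \sum_(l < n) c l * tnth tau l ^+ j = 0) ->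
  annihilates m c (tnth tau).
Proof.
move=> c0 p sp.
under eq_bigr do rewrite (horner_coef_wide _ sp) mulr_sumr.
rewrite exchange_big big1// => j _ /=.
under eq_bigr do rewrite mulrCA.
by rewrite -mulr_sumr c0 mulr0.
Qed.

Let semi_spline_eq v g : annihilates m (kn v) (tnth tau) ->
  semi (spline v) g = r`!%:R * \sum_(l < n) kn v l * g (tnth tau l).
Proof.
move=> ann; rewrite /spline semiDl semi_spline//.
by rewrite semi_poly_elt ?addr0// size_poly.
Qed.

Let system_eq0 v : system v = 0 -> v = 0.
Proof.
rewrite /system -[0 in RHS]row_mx0 => /eq_row_mx[/rowP H /rowP c0].
have {c0} ann : annihilates m (kn v) (tnth tau).
  by apply: moments_annihilate => j; have := c0 j; rewrite !mxE.
have {}H l : spline v (tnth tau l) = - (weight * kn v l).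
  by have := H l; rewrite !mxE addrC => /eqP; rewrite addr_eq0 => /eqP.
have knv0 l : kn v l = 0.
  have := semi_ge0 (spline v); rewrite semi_spline_eq//.
  under eq_bigr do rewrite H mulrN mulrCA -expr2.
  rewrite sumrN -mulr_sumr mulrN oppr_ge0 => S0.
  have {}S0 : \sum_(l < n) kn v l ^+ 2 == 0.
    rewrite eq_le sumr_ge0 ?andbT; last by move=> i _; exact: sqr_ge0.
    by move: S0; rewrite !pmulr_rle0// ltr0n fact_gt0.
  move: S0; rewrite psumr_eq0; last by move=> i _; exact: sqr_ge0.
  by move=> /allP/(_ l (mem_index_enum _)); rewrite sqrf_eq0 => /eqP.
have p0 : rVpoly (rsubmx v) = 0.
  apply: (@polynomial_eq0 R n (tnth tau)) => //.
    exact: leq_trans (size_poly _ _) mn.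
  move=> l; have := H l; rewrite knv0 mulr0 oppr0 sobolevD sobolev_sum.
  rewrite big1 ?add0r; first by rewrite poly_eltE.
  by move=> i _; rewrite knv0 sobolevZ mul0r.
rewrite -[v]hsubmxK -[RHS]row_mx0; congr row_mx.
  by apply/rowP => l; rewrite [RHS]mxE; exact: knv0.
by rewrite -[LHS]rVpolyK p0 linear0.
Qed.

(** The Euler-Lagrange equation of the penalized least squares problem is
    solved by a spline that depends linearly on the data. *)
Lemma normal_equation : exists S : {linear 'rV[R]_n -> sobolev R m},
  forall y g, lambda * semi (S y) g =
    n%:R^-1 * \sum_(l < n) (y 0 l - S y (tnth tau l)) * g (tnth tau l).
Proof.
have [M fM] := injective_rowmap_inverse system_lin system_eq0.
pose S (y : 'rV[R]_n) := spline (row_mx y 0 *m M).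
have lS : linear S.
  move=> a y z; rewrite /S -spline_lin scalemxAl -mulmxDl.
  rewrite scale_row_mx add_row_mx.
  by rewrite scaler0 addr0.
pose lM := GRing.isLinear.Build R 'rV[R]_n (sobolev R m) *:%R S lS.
pose F : {linear 'rV[R]_n -> sobolev R m} := HB.pack S lM.
exists F => y g; rewrite -[F y]/(S y) /S.
have := fM (row_mx y 0); set v := row_mx y 0 *m M.
rewrite /system => /eq_row_mx[/rowP H /rowP c0].
have {c0} ann : annihilates m (kn v) (tnth tau).
  by apply: moments_annihilate => j; have := c0 j; rewrite !mxE.
rewrite semi_spline_eq//.
have -> : \sum_(l < n) (y 0 l - spline v (tnth tau l)) * g (tnth tau l) =
    weight * \sum_(l < n) kn v l * g (tnth tau l).
  rewrite mulr_sumr; apply: eq_bigr => l _.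
  by have := H l; rewrite !mxE => <-; rewrite addrK mulrA.
rewrite [LHS]mulrA [RHS]mulrA; congr (_ * _).
by rewrite [RHS]mulrC /weight mulfK// pnatr_eq0 -lt0n.
Qed.

(** By the normal equation, the criterion exceeds its value at [S y] by a
    nonnegative quadratic form, which is definite because there are at least [m]
    distinct nodes. *)
Lemma smoothing_spline_linear : exists S : {linear 'rV[R]_n -> sobolev R m},
  (forall y g, lambda * semi (S y) g =
    n%:R^-1 * \sum_(l < n) (y 0 l - S y (tnth tau l)) * g (tnth tau l)) /\
  forall u, smoothing_spline lambda tau u = S (\row_l u (tnth tau l)).
Proof.
have [S nS] := normal_equation; exists S; split => // u.
set y := \row_l _.
(* the increase of the criterion from [S y] to [S y + g] *)
pose excess g :=
  n%:R^-1 * \sum_(l < n) (g (tnth tau l)) ^+ 2 + lambda * semi g g.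
have crit g : penalized_criterion lambda tau u (S y + g) =
    penalized_criterion lambda tau u (S y) + excess g.
  rewrite /penalized_criterion /excess -!semi_sqr.
  have -> : semi (S y + g) (S y + g) =
      semi (S y) (S y) + 2 * semi (S y) g + semi g g.
    rewrite semiDl (semiDr (S y)) (semiDr g) (semiC g (S y)).
    by move: (semi (S y) _) (semi (S y) _) (semi g g) => a b c; ring.
  have -> : \sum_(l < n) (u (tnth tau l) - (S y + g) (tnth tau l)) ^+ 2 =
      \sum_(l < n) (u (tnth tau l) - S y (tnth tau l)) ^+ 2 +
      \sum_(l < n) (g (tnth tau l)) ^+ 2 -
      2 * \sum_(l < n) (y 0 l - S y (tnth tau l)) * g (tnth tau l).
    rewrite mulr_sumr -sumrN -!big_split; apply: eq_bigr => l _.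
    rewrite sobolevD mxE /=; move: (u _) (S y _) (g _) => a b c; ring.
  move: (nS y g).
  move: (semi (S y) (S y)) (semi (S y) g) (semi g g) => a b c.
  move: (\sum_(l < n) _ * _) (\sum_(l < n) _ ^+ 2) (\sum_(l < n) _ ^+ 2).
  move=> e f k H.
  rewrite !mulrDr mulrN [lambda * (2 * b)]mulrCA H; ring.
have excess_ge0 g : 0 <= excess g.
  rewrite addr_ge0 ?mulr_ge0 ?invr_ge0 ?ler0n ?semi_ge0 ?(ltW lambda_gt0)//.
  by apply: sumr_ge0 => l _; exact: sqr_ge0.
apply: xget_unique => [g|h hmin].
  have := crit (g - S y); rewrite (subrKC (S y) g) => ->.
  move: (excess_ge0 (g - S y)).
  by move: (penalized_criterion _ _ _ _) (excess _) => a b; rewrite lerDl.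
have : excess (h - S y) <= 0.
  have := hmin (S y); have := crit (h - S y); rewrite (subrKC (S y) h) => ->.
  by move: (penalized_criterion _ _ _ _) (excess _) => a b; rewrite gerDl.
move=> e0; have {e0} : excess (h - S y) == 0 by rewrite eq_le e0 excess_ge0.
rewrite paddr_eq0; last 2 first.
- rewrite mulr_ge0 ?invr_ge0 ?ler0n//.
  by apply: sumr_ge0 => l _; exact: sqr_ge0.
- by rewrite mulr_ge0 ?semi_ge0// ltW.
rewrite !mulf_eq0 invr_eq0 pnatr_eq0 (gtn_eqF n_gt0) (gt_eqF lambda_gt0) /=.
move=> /andP[s0 /eqP semi0]; apply/eqP; rewrite -subr_eq0; apply/eqP.
apply: (semi_eq0_eq0 tau_inj mn tau01 semi0) => l.
move: s0; rewrite psumr_eq0; last by move=> i _; exact: sqr_ge0.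
by move=> /allP/(_ l (mem_index_enum _)); rewrite sqrf_eq0 => /eqP.
Qed.

End smoothing_spline_existence.

(** * Measurability *)

Section inner_product.
Context {R : realType} {r : nat}.
Local Notation m := r.+1.
Variable B : {linear sobolev R m -> 'rV[R]_m}.
Implicit Types (u v w : sobolev R m) (c : R).

Lemma innerE u v : inner B u v = semi u v + \sum_(j < m) B u 0 j * B v 0 j.
Proof. by []. Qed.

Lemma innerC u v : inner B u v = inner B v u.
Proof.
by rewrite !innerE semiC; congr (_ + _); apply: eq_bigr => j _; rewrite mulrC.
Qed.

Lemma inner_linl c u v w :
  inner B (c *: u + v) w = c * inner B u w + inner B v w.
Proof.
rewrite !innerE semi_linl mulrDr addrACA; congr (_ + _).
rewrite mulr_sumr -big_split; apply: eq_bigr => j _ /=.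
by rewrite linearP !mxE mulrDl mulrA.
Qed.

Lemma innerZl c u w : inner B (c *: u) w = c * inner B u w.
Proof.
have := inner_linl c u 0 w; rewrite addr0 => ->.
have := inner_linl 1 (0 : sobolev R m) 0 w.
rewrite scaler0 addr0 mul1r; move: (inner B 0 w) => a /eqP.
by rewrite eq_sym -subr_eq0 addrK => /eqP ->; rewrite addr0.
Qed.

Lemma inner_suml (I : Type) (s : seq I) (a : I -> R) (f : I -> sobolev R m) w :
  inner B (\sum_(i <- s) a i *: f i) w = \sum_(i <- s) a i * inner B (f i) w.
Proof.
elim: s => [|i s IH]; last by rewrite !big_cons inner_linl IH.
by rewrite !big_nil -(scale0r (0 : sobolev R m)) innerZl mul0r.
Qed.

Lemma inner_ge0 u : 0 <= inner B u u.
Proof.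
rewrite innerE addr_ge0 ?semi_ge0//; apply: sumr_ge0 => j _.
by rewrite -expr2 sqr_ge0.
Qed.

Lemma cauchy_schwarz u v : `|inner B u v| <= inner_norm B u * inner_norm B v.
Proof.
have quad t : 0 <= inner B u u + 2 * t * inner B u v + t ^+ 2 * inner B v v.
  have := inner_ge0 (t *: v + u).
  rewrite inner_linl innerC [inner B u _]innerC !inner_linl (innerC v u).
  move: (inner B u u) (inner B u v) (inner B v v) => a b c.
  by rewrite [X in 0 <= X -> _](_ : _ = a + 2 * t * b + t ^+ 2 * c)//; ring.
rewrite -ler_sqr ?nnegrE ?mulr_ge0 ?sqrtr_ge0// exprMn !sqr_sqrtr ?inner_ge0//.
rewrite real_normK ?num_real//.
have := inner_ge0 v; move: quad (inner_ge0 u).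
move: (inner B u u) (inner B u v) (inner B v v) => a b c quad a0.
rewrite le_eqVlt => /predU1P[c0|c0]; last first.
  have := quad (- b / c).
  rewrite (_ : _ + _ = (a * c - b ^+ 2) / c); last by field; rewrite gt_eqF.
  by rewrite pmulr_lge0 ?invr_gt0// subr_ge0.
(* if [c = 0] and [b != 0], the form is affine in [t] with [-1] as a value *)
have [->|b0] := eqVneq b 0; first by rewrite expr0n/= mulr_ge0// -c0.
have := quad (- (a + 1) / (2 * b)); rewrite -c0 mulr0 addr0.
rewrite (_ : _ + _ = -1); last by field; rewrite b0.
by rewrite oppr_ge0 ler10.
Qed.

Lemma inner_norm_open_gt v c : (@open (hilbert B)) [set u | c < inner B u v].
Proof.
rewrite -[_ _]/(dist_open (inner_norm B) _) => u /= cu.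
have k0 : 0 < inner_norm B v + 1 by rewrite ltr_wpDl// sqrtr_ge0.
exists ((inner B u v - c) / (inner_norm B v + 1)) => [|w].
  by rewrite divr_gt0// subr_gt0.
rewrite ltr_pdivlMr// => uw.
have : `|inner B (w - u) v| < inner B u v - c.
  apply: le_lt_trans (cauchy_schwarz _ _) (le_lt_trans _ uw).
  by rewrite ler_wpM2l ?sqrtr_ge0// lerDl.
rewrite -scaleN1r addrC inner_linl mulN1r ltr_norml => /andP[+ _] /=.
by move: (inner B u v) (inner B w v) => a b; lra.
Qed.

Lemma measurable_inner v :
  measurable_fun setT (fun u : borel_hilbert B => inner B u v).
Proof.
apply: (@measurability _ _ (borel_hilbert B) R setT _ _
  (RGenOInfty.measurableE R)).
move=> _ [_ [c ->] <-].
rewrite setTI; apply: sub_sigma_algebra.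
have -> : (fun u : borel_hilbert B => inner B u v) @^-1` `]c, +oo[%classic =
    [set u : hilbert B | c < inner B u v].
  by apply/seteqP; split => u /=; rewrite in_itv/= andbT.
exact: inner_norm_open_gt.
Qed.

End inner_product.

Section measurable_tuples.
Context {R : realType} {n : nat}.

(** The open cube of center [q] and half-side [e]. *)
Definition cube (q : n.-tuple R) (e : R) : set (n.-tuple R) :=
  [set z | forall l, `|tnth z l - tnth q l| < e].

Lemma measurable_cube q e : measurable (cube q e).
Proof.
rewrite (_ : cube q e = \bigcap_(l in [set: 'I_n])
    ((fun z : n.-tuple R => tnth z l) @^-1` (ball (tnth q l) e : set R))).
  apply: fin_bigcap_measurable => // l _.
  rewrite -[X in measurable X]setTI; apply: measurable_tnth => //.
  exact: measurable_ball.
apply/seteqP; split => z /= H l.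
  by move=> _; rewrite /ball/= distrC; exact: H.
by have := H l Logic.I; rewrite /ball/= distrC.
Qed.

(** Open subsets of the finite product are countable unions of cubes. *)
Lemma measurable_union_cubes (V : set (n.-tuple R)) :
  (forall y, V y -> exists2 e, 0 < e & cube y e `<=` V) -> measurable V.
Proof.
move=> oV.
pose rcube (i : n.-tuple rat * nat) : set (n.-tuple R) :=
  cube [tuple ratr (tnth i.1 l) | l < n] (i.2.+1%:R^-1).
pose F i := if `[< rcube i `<=` V >] then rcube i else set0.
have -> : V = \bigcup_i F i.
  apply/seteqP; split => [y Vy|y [i _]]; last first.
    by rewrite /F; case: ifPn => // /asboolP; exact.
  have [e e0 yeV] := oV _ Vy.
  have e20 : 0 < e / 2 by rewrite divr_gt0.
  pose k := Num.truncn (e / 2)^-1.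
  have ke : k.+1%:R^-1 < e / 2.
    rewrite -[ltRHS]invrK ltf_pV2 ?posrE ?invr_gt0// ?ltr0n//.
    exact: truncnS_gt.
  have k0 : 0 < k.+1%:R^-1 :> R by rewrite invr_gt0 ltr0n.
  have /choice[q qy] : forall l : 'I_n, exists q : rat,
      `|tnth y l - ratr q| < k.+1%:R^-1.
    move=> l; have ltk : tnth y l < tnth y l + k.+1%:R^-1 by rewrite ltrDl.
    have [q] := rat_in_itvoo ltk.
    rewrite in_itv/= => /andP[q1 q2]; exists q.
    by rewrite distrC gtr0_norm ?subr_gt0// ltrBlDl.
  pose i : n.-tuple rat * nat := ([tuple q l | l < n], k).
  have yi : rcube i y by move=> l; rewrite !tnth_mktuple.
  exists i => //; rewrite /F; case: ifPn => // /asboolP[] z zi.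
  apply: yeV => l; have := zi l; have := yi l; rewrite !tnth_mktuple => a b.
  rewrite (splitr e) -[tnth z l](subrK (ratr (q l))) -addrA.
  apply: le_lt_trans (ler_normD _ _) _; apply: ltrD; first exact: lt_trans ke.
  by rewrite distrC; exact: lt_trans ke.
apply: countable_bigcupT_measurable => [|i]; first exact: countableP.
by rewrite /F; case: ifP => // _; exact: measurable_cube.
Qed.

End measurable_tuples.

(** * Optimal risks *)

Section optimal_risk_comparison.
Context {R : realType} {d d1 d2 : measure_display}.
Context {Omega : measurableType d}.
Context {Z1 : measurableType d1} {Z2 : measurableType d2}.
Variables (P : probability Omega R) (Y : Omega -> R).
Variables (X1 : Omega -> Z1) (X2 : Omega -> Z2) (S : Z1 -> Z2).
Hypotheses (mS : measurable_fun setT S) (XS : forall w, X2 w = S (X1 w)).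

(** Passing to a measurable function of the observation does not decrease the
    optimal risk. *)
Lemma bayes_error_comp : (bayes_error P X1 Y <= bayes_error P X2 Y)%E.
Proof.
apply: le_ereal_inf_tmp => _ [phi phi1 <-].
have mphi : measurable_fun setT (phi \o S) by exact: measurableT_comp.
pose psi : {mfun Z1 >-> R} := HB.pack (phi \o S)
  (isMeasurableFun.Build _ _ _ _ _ mphi).
apply: ereal_inf_lbound; exists psi; first by move=> z; exact: phi1.
by congr (P _); apply/seteqP; split => w /=; rewrite XS.
Qed.

Lemma bayes_mse_comp : (bayes_mse P X1 Y <= bayes_mse P X2 Y)%E.
Proof.
apply: le_ereal_inf_tmp => _ [phi _ <-].
have mphi : measurable_fun setT (phi \o S) by exact: measurableT_comp.
pose psi : {mfun Z1 >-> R} := HB.pack (phi \o S)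
  (isMeasurableFun.Build _ _ _ _ _ mphi).
apply: ereal_inf_lbound; exists psi => //.
by congr expectation; apply/funext => w; rewrite XS.
Qed.

End optimal_risk_comparison.

(** * Samples and splines determine each other *)

Section spline_estimate_measurability.
Context {R : realType} {r n : nat}.
Local Notation m := r.+1.
Variable B : {linear sobolev R m -> 'rV[R]_m}.
Variable S : {linear 'rV[R]_n -> sobolev R m}.
Implicit Types y : 'rV[R]_n.

Let elt (l : 'I_n) : sobolev R m := S (delta_mx 0 l).

Let S_sum y : S y = \sum_(l < n) y 0 l *: elt l.
Proof.
rewrite {1}[y]row_sum_delta linear_sum; apply: eq_bigr => l _.
by rewrite linearZ.
Qed.

(** The Gram matrix of the images under [S] of the canonical basis. *)
Definition gram : 'M[R]_n := \matrix_(l, k) inner B (elt l) (elt k).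

Lemma inner_gram y k : inner B (S y) (elt k) = (y *m gram) 0 k.
Proof.
rewrite S_sum inner_suml mxE; apply: eq_bigr => l _.
by rewrite mxE.
Qed.

Lemma inner_gram2 y :
  inner B (S y) (S y) = \sum_(k < n) y 0 k * (y *m gram) 0 k.
Proof.
rewrite {1}S_sum inner_suml; apply: eq_bigr => k _.
by rewrite innerC inner_gram.
Qed.

Lemma inner_norm_linear_bound : exists2 C : R, 0 < C & forall y (e : R),
  0 <= e -> (forall l, `|y 0 l| <= e) -> inner_norm B (S y) <= e * C.
Proof.
pose K := \sum_(k < n) \sum_(l < n) `|gram l k|.
have K0 : 0 <= K by apply: sumr_ge0 => k _; exact: sumr_ge0.
exists (Num.sqrt K + 1) => [|y e e0 ye]; first by rewrite ltr_wpDl// sqrtr_ge0.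
apply: (@le_trans _ _ (e * Num.sqrt K)); last by rewrite ler_wpM2l// lerDl.
rewrite -[e in leRHS]ger0_norm// -sqrtr_sqr -sqrtrM ?sqr_ge0// ler_wsqrtr//.
rewrite inner_gram2 mulr_sumr; apply: ler_sum => k _.
rewrite mxE !mulr_sumr; apply: ler_sum => l _.
apply: le_trans (ler_norm _) _; rewrite mulrA !normrM ler_wpM2r//.
by rewrite expr2 ler_pM.
Qed.

(** The preimage of an open set is open, hence a union of cubes. *)
Lemma measurable_linear : measurable_fun setT
  (fun y : n.-tuple R => S (\row_l tnth y l) : borel_hilbert B).
Proof.
apply: (@measurability _ _ (n.-tuple R) (borel_hilbert B) setT _
  (@open (hilbert B))) => // _ [U oU <-].
rewrite setTI; apply: measurable_union_cubes => y Uy.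
have [e e0 Ue] : exists2 e : R, 0 < e &
    forall v, inner_norm B (v - S (\row_l tnth y l)) < e -> U v by exact: oU.
have [C C0 SC] := inner_norm_linear_bound.
exists (e / (2 * C)) => [|z yz]; first by rewrite divr_gt0// mulr_gt0.
apply: Ue; rewrite -linearB.
apply: (@le_lt_trans _ _ (e / (2 * C) * C)).
  apply: SC => [|l]; first by rewrite divr_ge0 ?mulr_ge0 ?ltW.
  by rewrite !mxE ltW//; exact: yz.
rewrite invfM mulrA mulfVK ?gt_eqF//; lra.
Qed.

Lemma measurable_coordinates (M : 'M[R]_n) : measurable_fun setT
  (fun h : borel_hilbert B =>
    [tuple ((\row_k inner B h (elt k)) *m M) 0 l | l < n] : n.-tuple R).
Proof.
apply/measurable_fun_tnthP => l.
rewrite (_ : _ \o _ = fun h : borel_hilbert B =>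
  \sum_(k < n) inner B h (elt k) * M k l).
  apply: measurable_sum => k; apply: measurable_funM => //.
  exact: measurable_inner.
apply/funext => h /=; rewrite tnth_mktuple mxE; apply: eq_bigr => k _.
by rewrite mxE.
Qed.

Lemma linear_left_inverse : (forall y, inner B (S y) (S y) = 0 -> y = 0) ->
  exists2 T : borel_hilbert B -> n.-tuple R, measurable_fun setT T &
    forall y : n.-tuple R, T (S (\row_l tnth y l)) = y.
Proof.
move=> S0; have gU : gram \in unitmx.
  rewrite -row_free_unit; apply/inj_row_free => y yg; apply: S0.
  by rewrite inner_gram2 yg big1// => k _; rewrite mxE mulr0.
exists (fun h =>
  [tuple ((\row_k inner B h (elt k)) *m invmx gram) 0 l | l < n]).
  exact: measurable_coordinates.
move=> y; apply: eq_from_tnth => l; rewrite tnth_mktuple.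
rewrite (_ : \row_k _ = (\row_l tnth y l) *m gram); last first.
  by apply/rowP => k; rewrite mxE inner_gram.
by rewrite mulmxK// mxE.
Qed.

End spline_estimate_measurability.

Section smoothing_spline_information.
Context {R : realType} {r n : nat}.
Local Notation m := r.+1.
Variables (tau : n.-tuple R) (lambda : R).
Variable B : {linear sobolev R m -> 'rV[R]_m}.
Hypotheses (tau01 : forall i, 0 <= tnth tau i <= 1).
Hypotheses (tau_inj : injective (tnth tau)) (mn : (m <= n)%N).
Hypotheses (bB : boundary_operator B) (iB : independent_from_evaluations B tau).
Hypothesis lambda_gt0 : 0 < lambda.

Lemma inner_eq0 u : inner B u u = 0 -> u = 0.
Proof.
have sB0 : 0 <= \sum_(j < m) B u 0 j * B u 0 j.
  by apply: sumr_ge0 => j _; rewrite -expr2 sqr_ge0.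
move=> /eqP; rewrite innerE paddr_eq0 ?semi_ge0// => /andP[/eqP s0].
rewrite psumr_eq0 => [/allP B0|j _]; last by rewrite -expr2 sqr_ge0.
have [_ _ kerB] := bB; apply: kerB; last exact: semi_eq0_polynomial.
apply/rowP => j; rewrite mxE; apply/eqP.
by have := B0 j (mem_index_enum _); rewrite -expr2 sqrf_eq0.
Qed.

(** The sample and the smoothing spline are measurable functions of each
    other. *)
Lemma smoothing_spline_equivalence :
  exists2 S : n.-tuple R -> borel_hilbert B, measurable_fun setT S &
  exists2 T : borel_hilbert B -> n.-tuple R, measurable_fun setT T &
  forall u, smoothing_spline lambda tau u = S (sampling tau u) /\
    sampling tau u = T (smoothing_spline lambda tau u).
Proof.
have [S [nS SE]] := smoothing_spline_linear tau01 tau_inj mn lambda_gt0.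
have S0 y : S y = 0 -> y = 0.
  move=> Sy0; apply/rowP => l; rewrite mxE.
  have y_ortho (g : sobolev R m) : \sum_(l < n) y 0 l * g (tnth tau l) = 0.
    have /eqP := nS y g; rewrite Sy0 semi0l mulr0 eq_sym mulf_eq0 invr_eq0.
    rewrite pnatr_eq0 gtn_eqF ?(leq_trans _ mn)// => /eqP E; rewrite -[RHS]E.
    by apply: eq_bigr => k _; rewrite sobolev0 subr0.
  have comb0 (g : sobolev R m) : \sum_(j < m) 0 * B g 0 j +
      \sum_(k < n) y 0 k * g (tnth tau k) = 0.
    by rewrite y_ortho addr0 big1// => j _; rewrite mul0r.
  by have [_ y0] := iB comb0; exact: y0.
have [T mT TS] :=
  @linear_left_inverse R r n B S (fun y Sy => S0 _ (inner_eq0 Sy)).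
exists (fun y => S (\row_l tnth y l)); first exact: measurable_linear.
exists T => // u; rewrite SE.
have -> : \row_l u (tnth tau l) = \row_l tnth (sampling tau u) l.
  by apply/rowP => l; rewrite !mxE tnth_mktuple.
by split => //; rewrite TS.
Qed.

End smoothing_spline_information.
Theorem corollary1 (R : realType) (m n : nat) (tau : n.-tuple R)
    (B : {linear sobolev R m -> 'rV[R]_m}) (lambda : R)
    (d : measure_display) (Omega : measurableType d) (P : probability Omega R)
    (X : {RV P >-> borel_hilbert B}) (Y : {RV P >-> R}) :
  (1 <= m)%N ->
  (forall t, t \in tau -> 0 <= t <= 1) ->
  uniq tau ->
  (m <= n)%N ->
  boundary_operator B ->
  independent_from_evaluations B tau ->
  0 < lambda ->
  let Xtau := fun w => sampling tau (X w) in
  let Xhat := fun w => (smoothing_spline lambda tau (X w) : borel_hilbert B) in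
  ((forall w, Y w = -1 \/ Y w = 1) ->
     bayes_error P Xhat Y = bayes_error P Xtau Y) /\
  (('E_P[fun w => (Y w ^+ 2)%R] < +oo)%E ->
     bayes_mse P Xhat Y = bayes_mse P Xtau Y).
Proof.
case: m B X => // r B X _ tau01 utau mn bB iB lambda_gt0 Xtau Xhat.
have tnth01 i : 0 <= tnth tau i <= 1 by apply: tau01; exact: mem_tnth.
have tau_inj : injective (tnth tau).
  exact/tuple_uniqP.
have [S mS [T mT ST]] :=
  smoothing_spline_equivalence tnth01 tau_inj mn bB iB lambda_gt0.
have XS w : Xhat w = S (Xtau w) by have [] := ST (X w).
have XT w : Xtau w = T (Xhat w) by have [] := ST (X w).
split=> _; apply/eqP; rewrite eq_le; apply/andP; split.
- exact: bayes_error_comp mT XT.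
- exact: bayes_error_comp mS XS.
- exact: bayes_mse_comp mT XT.
- exact: bayes_mse_comp mS XS.
Qed.
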